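(* Let $n\ge 2$ and let $\xi_1,\ldots,\xi_n$ be independent nonnegative random variables with finite moments of all positive orders, $\xi_i$ having distribution function $F_i$. Suppose that each $F_i$ is absolutely continuous with density $f_i>0$ on $(0,\infty)$, and that the following conditions are satisfied: (i) At least one of the densities $f_1(x),\ldots,f_n(x)$ is decreasing in $x\ge x_0$, where $x_0\ge 1$ is a constant. (ii) For each $i=1,2,\ldots,n$, there exists a constant $A_i>0$ such that the density $f_i$ and the tail function $\overline{F_i}=1-F_i$ satisfy $$\frac{f_i(x)}{\overline{F_i}(x)}\ge \frac{A_i}{x}\quad\text{for } x\ge x_0,$$ and there exist constants $B_i>0$, $\alpha_i>0$, $\beta_i>0$ and real $\gamma_i$ such that $$\overline{F_i}(x)\ge B_i x^{\gamma_i}e^{-\alpha_i x^{\beta_i}}\quad\text{for } x\ge x_0.$$ If, in addition to (i) and (ii), the parameters $\beta_1,\ldots,\beta_n$ are such that $\sum_{i=1}^n\frac{1}{\beta_i}>2$, then the product $Z_n=\xi_1\xi_2\cdots\xi_n$ is M-indet.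
   Context: A random variable $X$ with distribution function $F$ and moments $m_k=\mathbf{E}[X^k]$ (all finite) is called moment determinate (M-det) if $F$ is the only distribution having the moment sequence $\{m_k\}_{k=1}^\infty$; otherwise it is called moment indeterminate (M-indet). *)

(* Defs.v *)
From HB Require Import structures.
From mathcomp Require Import all_boot all_order all_algebra.
From mathcomp Require Import all_classical all_reals all_analysis.

Set Implicit Arguments.
Unset Strict Implicit.
Unset Printing Implicit Defensive.

Import Order.TTheory GRing.Theory Num.Theory.
Import numFieldNormedType.Exports.

Local Open Scope classical_set_scope.
Local Open Scope ring_scope.

Definition moment (R : realType) (mu : probability R R)
    (k : nat) : \bar R :=
  (\int[mu]_x (x ^+ k)%:E)%E.

Definition finite_moments (R : realType)
    (mu : probability R R) : Prop :=
  forall k : nat, (0 < k)%N -> mu.-integrable setT (fun x => (x ^+ k)%:E).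

(* The competing distributions [nu] range over all probability laws on the
   whole real line, not only over those supported on the half-line (that is,
   Hamburger rather than Stieltjes determinacy). *)
Definition determined_by_moments (R : realType)
    (mu : probability R R) : Prop :=
  forall nu : probability R R,
    finite_moments nu ->
    (forall k : nat, (0 < k)%N -> moment nu k = moment mu k) ->
    forall A : set R, measurable A -> nu A = mu A.

Definition M_det (d : measure_display) (T : measurableType d) (R : realType)
    (P : probability T R) (X : {RV P >-> R}) : Prop :=
  finite_moments (distribution P X) /\
  determined_by_moments (distribution P X).

(* Both notions presuppose finite moments, so this is not the bare
   negation of [M_det]. *)
Definition M_indet (d : measure_display) (T : measurableType d) (R : realType)
    (P : probability T R) (X : {RV P >-> R}) : Prop :=
  finite_moments (distribution P X) /\ ~ M_det X.

(* For finitely many variables, the product rule over all subfamilies follows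
   by taking [A i = setT] outside the subfamily. *)
Definition mutually_independent (d : measure_display) (T : measurableType d)
    (R : realType) (P : probability T R) (n : nat)
    (X : 'I_n -> {RV P >-> R}) : Prop :=
  forall A : 'I_n -> set R, (forall i, measurable (A i)) ->
    P (\bigcap_i (X i @^-1` A i)) = (\prod_(i < n) P (X i @^-1` A i))%E.

(* An actual function, not a class modulo null sets: pointwise hypotheses on
   [f] refer to this chosen version of the density. *)
Definition has_density (d : measure_display) (T : measurableType d)
    (R : realType) (P : probability T R) (X : {RV P >-> R}) (f : R -> R) :
    Prop :=
  [/\ measurable_fun setT f,
      forall x, 0 <= f x &
      forall x, cdf X x = (\int[lebesgue_measure]_(t in `]-oo, x]) (f t)%:E)%E].

Definition tail (d : measure_display) (T : measurableType d) (R : realType)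
    (P : probability T R) (X : {RV P >-> R}) (x : R) : R :=
  fine (1 - cdf X x)%E.

Definition prod_fun (d : measure_display) (T : measurableType d)
    (R : realType) (P : probability T R) (n : nat)
    (X : 'I_n -> {RV P >-> R}) (w : T) : R :=
  \prod_(i < n) X i w.

Section prod_fun_measurable.
Context (d : measure_display) (T : measurableType d) (R : realType)
  (P : probability T R) (n : nat) (X : 'I_n -> {RV P >-> R}).

Lemma measurable_prod_fun : measurable_fun setT (prod_fun X).
Proof. by apply: measurable_prod => i _; exact: measurable_funPT. Qed.

HB.instance Definition _ :=
  isMeasurableFun.Build _ _ _ _ (prod_fun X) measurable_prod_fun.

End prod_fun_measurable.

(* Main.v *)
Require Import Defs.
From HB Require Import structures.
From mathcomp Require Import all_boot all_order all_algebra.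
From mathcomp Require Import all_classical all_reals all_analysis.
From mathcomp Require Import measurable_realfun ring lra.

(** Let 1/theta be the sum of the 1/beta_i, so that theta < 1/2. The law of the
    product Z dominates c exp(- C x^theta) dx on some half-line [z, +oo[, which
    leaves room to add to it a signed density all of whose moments vanish: the
    result is another probability law with the same moments.

    The signed density is a translate of Stieltjes' function
      exp(- x^l cos(l pi)) sin(x^l sin(l pi)),  x > 0,  theta < l < 1/2.
    Its k-th moment is, up to sign, the imaginary part of the integral of
    z^k exp(- z^l) dz along the ray of argument - pi. By Cauchy's theorem in the
    sector between this ray and the positive half-line, where z^l stays in the
    right half-plane because l < 1/2, that integral equals its value along the
    positive half-line, which is real ([stieltjes_moment]). Cauchy's theorem is
    proved by hand in polar coordinates ([is_derive_integral_ray]). Multiplied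
    by a small constant, the translate to z is at most c exp(- C x^theta) in
    absolute value, since theta < l ([stretched_exponential_comparison]), and so
    may be added to the law ([not_determined_of_stretched_exponential]).

    For the lower bound, consider Z near w and put a_i = w^(theta/beta_i), so
    that the product of the a_i is w and all the tails P(xi_i > 2 a_i) decay like
    exp(- const w^theta) ([tail_at_power_scale]). Let i0 be the index of the
    decreasing density. By the hazard condition each other factor lies in
    ]a_i, 2 a_i] with probability at least (A_i/2) P(xi_i > 2 a_i)
    ([hazard_doubling]); given these factors, Z has near w a density that
    monotonicity and the hazard condition at 2 a_i0 bound from below
    ([product_law_lower_bound]). Multiplying the bounds gives
    [product_window_bound] for sets contained in [w, 2 w], and cutting the
    half-line into unit windows gives the bound for all its measurable subsets
    ([lower_bound_of_unit_windows]). *)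

Set Implicit Arguments.
Unset Strict Implicit.
Unset Printing Implicit Defensive.

Import Order.TTheory GRing.Theory Num.Theory.
Import numFieldNormedType.Exports.

Local Open Scope classical_set_scope.
Local Open Scope ring_scope.

(** * Moments of the Stieltjes function *)

Lemma continuous_measurable_fun_EFin (R : realType) (D : set R) (f : R -> R) :
  continuous f -> measurable_fun D (fun x => (f x)%:E).
Proof.
move=> cf; apply/measurable_EFinP; apply: (@measurable_funS _ _ _ _ setT) => //.
exact: continuous_measurable_fun.
Qed.

(** A stretched exponential beats every power. The majorant [C / (1 + x ^+ 2)]
    is integrable and vanishes at infinity, which serves both to integrate the
    moments and to discard the far side of the contour. *)
Lemma powR_expR_dominated (R : realType) (c l : R) (m : nat) :
  0 < c -> 0 < l ->
  exists2 C : R, 0 < C &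
    forall x, 0 <= x -> x ^+ m * expR (- (c * x `^ l)) <= C / (1 + x ^+ 2).
Proof.
move=> c0 l0.
(* With this [N] the term of degree [N.+1] in the exponential series of
   [c * x `^ l] already dominates [x ^+ (m + 2)] on [1, +oo[. *)
set N := Num.truncn ((m + 2)%:R / l).
have lN : (m + 2)%:R <= l * N.+1%:R.
  rewrite -ler_pdivrMl // mulrC ltW //.
  by have /andP[] := truncn_itv (divr_ge0 (ler0n R (m+2)) (ltW l0)).
set K : R := (N.+1)`!%:R / c ^+ N.+1.
have K0 : 0 < K by rewrite divr_gt0 ?exprn_gt0 // ltr0n fact_gt0.
exists (2 * K + 2) => [|x x0]; first lra.
have D0 : 0 < 1 + x ^+ 2 by have := sqr_ge0 x; lra.
rewrite ler_pdivlMr //.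
have [x1|x1] := leP x 1.
  apply: (@le_trans _ _ (1 * (1 + 1))); last lra.
  apply: ler_pM => //; first by rewrite mulr_ge0 ?exprn_ge0 ?expR_ge0.
  - lra.
  - rewrite -[leRHS]mulr1 ler_pM ?exprn_ge0 ?expR_ge0 ?exprn_ile1 //.
    by rewrite -expR0 ler_expR oppr_le0 mulr_ge0 ?powR_ge0 // ltW.
  - by rewrite lerD2l exprn_ile1.
have xp : 0 < x by lra.
have y0 : 0 < c * x `^ l by rewrite mulr_gt0 ?powR_gt0.
have xm2 : x ^+ (m + 2) <= (x `^ l) ^+ N.+1.
  rewrite -!powR_mulrn ?powR_ge0 // -powRrM ler_powR //; exact: ltW.
have eb : expR (- (c * x `^ l)) <= K / x ^+ (m + 2).
  rewrite expRN -[leRHS]invrK lef_pV2 ?posrE ?expR_gt0 //; last first.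
    by rewrite invr_gt0 divr_gt0 ?exprn_gt0.
  have := expR_ge1Dxn N (ltW y0); apply: le_trans.
  rewrite invfM invrK /K invf_div mulrAC exprMn.
  have : c ^+ N.+1 * x ^+ (m + 2) / (N.+1)`!%:R <=
     c ^+ N.+1 * (x `^ l) ^+ N.+1 / (N.+1)`!%:R.
    rewrite ler_pM2r ?invr_gt0 ?ltr0n ?fact_gt0 //.
    by rewrite ler_pM2l ?exprn_gt0.
  lra.
have x2 : 1 <= x ^+ 2 by rewrite exprn_ege1 // ltW.
apply: (@le_trans _ _ (x ^+ m * (K / x ^+ (m + 2)) * (x ^+ 2 * 2))).
  apply: ler_pM; rewrite ?mulr_ge0 ?exprn_ge0 ?expR_ge0 //; try lra.
  by rewrite ler_pM2l // exprn_gt0.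
have -> : x ^+ m * (K / x ^+ (m + 2)) * (x ^+ 2 * 2) = 2 * K; last lra.
by rewrite exprD; field; rewrite ?expf_neq0 ?gt_eqF.
Qed.

(** Truncating at zero makes the power continuous on the whole line, since
    [powR] takes the value [1] at negative reals. *)
Definition powR_pos (R : realType) (l x : R) : R := Num.max 0 x `^ l.

Section powR_pos.
Context {R : realType} (l : R).
Hypothesis l0 : 0 < l.
Local Notation r := (powR_pos l).

Lemma powR_pos_ge0 x : 0 <= r x. Proof. exact: powR_ge0. Qed.

Lemma powR_pos_le0 x : x <= 0 -> r x = 0.
Proof. by move=> x0; rewrite /powR_pos max_l // powR0 // gt_eqF. Qed.

Lemma powR_posE x : 0 <= x -> r x = x `^ l.
Proof. by move=> x0; rewrite /powR_pos max_r. Qed.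

Lemma is_derive_powR_pos (x : R) : 0 < x -> is_derive x 1 r (l * x `^ (l - 1)).
Proof.
move=> x0; apply: near_eq_is_derive (is_derive1_powR l x0).
by near=> y; rewrite powR_posE //; near: y; exact: lt_le_nbhsr.
Unshelve. all: by end_near. Qed.

Lemma continuous_powR_pos : continuous r.
Proof.
move=> x; have [x0|x0|->] := ltgtP x 0.
- apply: (@cvg_trans _ ((fun=> 0 : R) @ x)).
    by apply: near_eq_cvg; near=> y; rewrite powR_pos_le0 //; near: y;
      exact: lt_le_nbhsl.
  rewrite powR_pos_le0 ?ltW //. exact: (@cvg_cst R 0 R (nbhs x) _).
- have [dr _] := is_derive_powR_pos x0.
  by apply: differentiable_continuous; exact/derivable1_diffP.
- apply/left_right_continuousP; rewrite powR_pos_le0 //; split.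
    apply: (@cvg_trans _ ((fun=> 0 : R) @ 0^'-)); last exact: (@cvg_cst R 0 R (0^'-) _).
    by apply: near_eq_cvg; near=> y; rewrite powR_pos_le0.
  apply: cvg_trans (powR_cvg0 l0).
  by apply: near_eq_cvg; near=> y; rewrite powR_posE.
Unshelve. all: by end_near. Qed.
End powR_pos.

Section sector.
Context {R : realType} (l : R) (k : nat).
Hypothesis l0 : 0 < l.
Local Notation mu := lebesgue_measure.
Local Notation r := (powR_pos l).
Local Notation s := (k.+1%:R / l).

Let u t x := r x * sin t - s * t.
Let e t x := expR (- (r x * cos t)).

(** The imaginary part of [z^k exp(- z^l) dz] on the ray
    [z = x exp(- i t / l)], where [z^l = x^l exp(- i t)] and
    [z^k dz = x^k exp(- i s t) dx] with [s = (k + 1) / l]. *)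
Definition ray_integrand (t x : R) : R := x ^+ k * e t x * sin (u t x).
(** The derivative of [ray_integrand] in the angle [t]. *)
Definition ray_integrand_angle (t x : R) : R :=
  x ^+ k * e t x * (r x * sin t * sin (u t x) + (r x * cos t - s) * cos (u t x)).
(** The component of the same differential form in the angular direction; the
    form being closed, its derivative in [x] is the derivative of the radial
    component in [t]. *)
Definition ray_primitive (t x : R) : R := - (x ^+ k.+1 / l) * e t x * cos (u t x).

Let cu t : continuous (u t).
Proof.
move=> x; apply: cvgB; last exact: cvg_cst.
by apply: cvgMr_tmp; exact: continuous_powR_pos.
Qed.

Let ce t : continuous (e t).
Proof.
move=> x; apply: continuous_comp; last exact: continuous_expR.
by apply: cvgN; apply: cvgMr_tmp; exact: continuous_powR_pos.
Qed.

Let ccosu t : continuous (fun x => cos (u t x)).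
Proof. by move=> x; apply: continuous_comp; [exact: cu|exact: continuous_cos]. Qed.

Let csinu t : continuous (fun x => sin (u t x)).
Proof. by move=> x; apply: continuous_comp; [exact: cu|exact: continuous_sin]. Qed.

Lemma continuous_ray_integrand t : continuous (ray_integrand t).
Proof.
move=> x; apply: cvgM; last exact: csinu.
by apply: cvgM; [exact: exprn_continuous|exact: ce].
Qed.

Lemma continuous_ray_integrand_angle t : continuous (ray_integrand_angle t).
Proof.
move=> x; apply: cvgM.
  by apply: cvgM; [exact: exprn_continuous|exact: ce].
apply: cvgD.
  apply: cvgM; last exact: csinu.
  by apply: cvgMr_tmp; exact: continuous_powR_pos.
apply: cvgM; last exact: ccosu.
apply: cvgB; last exact: cvg_cst.
by apply: cvgMr_tmp; exact: continuous_powR_pos.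
Qed.

Lemma continuous_ray_primitive t : continuous (ray_primitive t).
Proof.
move=> x; apply: cvgM; last exact: ccosu.
apply: cvgM; last exact: ce.
by apply: cvgN; apply: cvgMr_tmp; exact: exprn_continuous.
Qed.

Lemma is_derive_ray_integrand (x t : R) :
  is_derive t 1 (ray_integrand ^~ x) (ray_integrand_angle t x).
Proof.
rewrite /ray_integrand /ray_integrand_angle /e /u.
apply: is_derive_eq.
rewrite /GRing.scale /=.
ring.
Qed.

Lemma is_derive_ray_primitive t (x : R) : 0 < x ->
  is_derive x 1 (ray_primitive t) (ray_integrand_angle t x).
Proof.
move=> x0; rewrite /ray_primitive /ray_integrand_angle /e /u.
set dr := l * x `^ (l - 1).
have Dr : is_derive x 1 r dr by exact: is_derive_powR_pos.
have D1 c : is_derive x 1 (fun y => r y * c) (c * dr).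
  have -> : (fun y => r y * c) = c \*: r by apply/funext => y; rewrite /= mulrC.
  exact: is_deriveZ.
have De : is_derive x 1 (fun y => expR (- (r y * cos t)))
    (- (cos t * dr) * expR (- (r x * cos t))).
  have D2 : is_derive x 1 (fun y => - (r y * cos t)) (- (cos t * dr)).
    exact: is_deriveN.
  by apply: is_derive_eq; rewrite /GRing.scale /= mulrC.
have Dc : is_derive x 1 (fun y => cos (r y * sin t - s * t))
    (- (sin t * dr) * sin (r x * sin t - s * t)).
  have D2 : is_derive x 1 (fun y => r y * sin t - s * t) (sin t * dr - 0).
    exact: is_deriveB.
  by apply: is_derive_eq; rewrite /GRing.scale /= subr0; ring.
have Dp : is_derive x 1 (fun y : R => - (y ^+ k.+1 / l))
    (- (s * x ^+ k)).
  have DX : is_derive x 1 (@GRing.exp R ^~ k.+1) (k.+1%:R * x ^+ k).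
    have := @is_deriveX R R id k.+1 x 1 1 (is_derive_id _ _).
    by rewrite exprfctE /= /GRing.scale /= mulr1.
  have := is_deriveZ (- l^-1) DX; rewrite /GRing.scale /=.
  have -> : (- l^-1 \*: (@GRing.exp R ^~ k.+1) : R -> R) = (fun y : R => - (y ^+ k.+1 / l)).
    by apply/funext => y; rewrite /= /GRing.scale /= mulrC mulrN.
  by move=> D; apply: (is_derive_eq D); field; rewrite gt_eqF.
have xdr : x * dr = l * r x.
  by rewrite powR_posE ?ltW // /dr mulrCA mulr_powRB1 // ltW.
apply: (is_derive_eq (is_deriveM (is_deriveM Dp De) Dc)).
rewrite /GRing.scale fctE /=.
have -> : x ^+ k.+1 = x ^+ k * x by rewrite exprSr.
set C := cos (_ - _); set S := sin (_ - _); set E := expR _.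
have -> : dr = l * r x / x by rewrite -xdr mulrAC mulfV ?mul1r // gt_eqF.
field; rewrite ?gt_eqF //.
Qed.

End sector.

Section sector_integral.
Context {R : realType} (l : R) (k : nat).
Hypothesis l0 : 0 < l.
Local Notation mu := (@lebesgue_measure R).
Local Notation r := (powR_pos l).
Local Notation s := (k.+1%:R / l).
Local Notation q := (ray_integrand l k).
Local Notation dq := (ray_integrand_angle l k).
Local Notation p := (ray_primitive l k).

Lemma continuous_segment_integrable (f : R -> R) (a b : R) :
  continuous f -> mu.-integrable `[a, b] (EFin \o f).
Proof.
move=> cf; apply: continuous_compact_integrable; first exact: segment_compact.
exact: continuous_subspaceT.
Qed.

(** The boundary term at the vertex of the sector is zero, so only the arc of
    radius [N] contributes. *)
Lemma integral_ray_integrand_angle (N t : R) : 0 < N ->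
  (\int[mu]_(x in `[0, N]) dq t x)%R = p t N.
Proof.
move=> N0; rewrite /Rintegral (@continuous_FTC2 _ _ (p t)) //=.
- by rewrite {2}/ray_primitive expr0n /= !mul0r oppr0 !mul0r subr0.
- by apply: continuous_subspaceT; exact: continuous_ray_integrand_angle.
- split.
  + move=> x; rewrite in_itv /= => /andP[x0 _].
    by have [] := is_derive_ray_primitive k l0 t x0.
  + by apply: cvg_at_right_filter; exact: continuous_ray_primitive.
  + by apply: cvg_at_left_filter; exact: continuous_ray_primitive.
- move=> x; rewrite in_itv /= => /andP[x0 _].
  by rewrite derive1E; have [_ ->] := is_derive_ray_primitive k l0 t x0.
Qed.

Lemma ray_integrand_angle_bound (t x : R) :
  `|dq t x| <= `|x| ^+ k * expR (r x) * (r x + (r x + s)).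
Proof.
have r0 := powR_pos_ge0 l x.
have s0 : 0 <= s by rewrite divr_ge0 // ltW.
have c1 (y : R) : `|cos y| <= 1 by rewrite ler_norml cos_geN1 cos_le1.
have s1 (y : R) : `|sin y| <= 1 by rewrite ler_norml sin_geN1 sin_le1.
have rc (y : R) : `|y| <= 1 -> `|r x * y| <= r x.
  by move=> y1; rewrite normrM ger0_norm // ler_piMr.
rewrite /ray_integrand_angle normrM ler_pM ?normr_ge0 //.
  rewrite normrM normrX ler_wpM2l ?exprn_ge0 //.
  rewrite ger0_norm ?expR_ge0 // ler_expR.
  apply: le_trans (ler_norm _) _; rewrite normrN; exact: rc.
apply: le_trans (ler_normD _ _) _; apply: lerD.
  rewrite normrM -[leRHS]mulr1; apply: ler_pM => //; exact: rc.
rewrite normrM -[leRHS]mulr1; apply: ler_pM => //.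
apply: le_trans (ler_normB _ _) _; apply: lerD; first exact: rc.
by rewrite ger0_norm.
Qed.

(** Cauchy's theorem in infinitesimal form: turning the segment of length [N]
    changes the integral by the contribution of the arc that its end sweeps. *)
Lemma is_derive_integral_ray (N t : R) : 0 < N ->
  is_derive t 1 (fun t => \int[mu]_(x in `[0, N]) q t x)%R (p t N).
Proof.
move=> N0.
pose G (x : R) := `|x| ^+ k * expR (r x) * (r x + (r x + s)).
have cG : continuous G.
  have cr := continuous_powR_pos l0.
  move=> x; apply: cvgM.
    apply: cvgM; last by apply: continuous_comp; [exact: cr|exact: continuous_expR].
    apply: (@continuous_comp _ _ _ (fun y : R => `|y|) (fun y => y ^+ k)).
      exact: norm_continuous.
    exact: exprn_continuous.
  apply: cvgD; first exact: cr.
  by apply: cvgD; [exact: cr|exact: cvg_cst].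
have tI : [set` `](t - 1), (t + 1)[] t by rewrite /= in_itv /=; lra.
have intf : forall t', [set` `](t - 1), (t + 1)[] t' ->
    mu.-integrable `[0, N] (EFin \o q t').
  by move=> t' _; apply: continuous_segment_integrable; exact: continuous_ray_integrand.
have der t' x : [set` `](t - 1), (t + 1)[] t' -> [set` `[0, N]] x ->
    derivable (q ^~ x) t' 1.
  by move=> _ _; have [] := is_derive_ray_integrand l k x t'.
have E t' x : partial1of2 q t' x = dq t' x.
  by rewrite partial1of2E; have [_ ->] := is_derive_ray_integrand l k x t'.
have G0 x : 0 <= G x.
  rewrite !mulr_ge0 ?exprn_ge0 ?expR_ge0 // !addr_ge0 ?powR_pos_ge0 //.
  by rewrite divr_ge0 // ltW.
have Gub t' x : [set` `](t - 1), (t + 1)[] t' -> [set` `[0, N]] x ->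
    `|partial1of2 q t' x| <= G x.
  by move=> _ _; rewrite E; exact: ray_integrand_angle_bound.
have iG : mu.-integrable `[0, N] (EFin \o G) by exact: continuous_segment_integrable.
apply: DeriveDef.
  exact: (@derivable_under_integral _ _ _ mu q `[0, N] _ t _ _ tI intf der G).
rewrite -derive1E.
rewrite (@differentiation_under_integral _ _ _ mu q `[0, N] _ t _ _ tI intf der G) //.
under eq_Rintegral do rewrite E.
exact: integral_ray_integrand_angle.
Qed.

Lemma integral_ray_integrand0 (N : R) : (\int[mu]_(x in `[0, N]) q 0 x = 0)%R.
Proof.
under eq_Rintegral do rewrite /ray_integrand sin0 !mulr0 subr0 sin0 mulr0.
by rewrite Rintegral_cst //= mul0r.
Qed.

(** The integral vanishes at angle zero, where the form is real, and the arc
    contributes little because [cos] is bounded away from zero on [[0, t]]. *)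
Lemma integral_ray_bound (t : R) : 0 < t < pi / 2 ->
  exists2 K : R, 0 <= K & forall N, 0 < N ->
  `|\int[mu]_(x in `[0, N]) q t x|%R <= K / (1 + N ^+ 2).
Proof.
move=> /andP[t0 tpi].
have ct : 0 < cos t by apply: cos_gt0_pihalf; rewrite tpi andbT; have := pi_gt0 R; lra.
have [C C0 HC] := powR_expR_dominated k.+1 ct l0.
exists (C / l * t) => [|N N0]; first by rewrite mulr_ge0 ?divr_ge0 // ltW.
have H1 := fun x (_ : x \in `]0, t[) => is_derive_integral_ray x N0.
have H2 : {within `[0, t], continuous (fun t => \int[mu]_(x in `[0, N]) q t x)%R}.
  apply: derivable_within_continuous => x _.
  by have [] := is_derive_integral_ray x N0.
have [c ] := MVT t0 H1 H2.
rewrite integral_ray_integrand0 !subr0 => c0t ->.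
move: c0t; rewrite in_itv /= => /andP[c0 ct'].
rewrite normrM (ger0_norm (ltW t0)) -[leRHS]mulrA (mulrC t) mulrA.
rewrite ler_pM2r // /ray_primitive normrM normrM normrN normrM.
rewrite normrX (ger0_norm (ltW N0)) (ger0_norm (expR_ge0 _)).
have li : 0 < l^-1 by rewrite invr_gt0.
rewrite (ger0_norm (ltW li)).
apply: (@le_trans _ _ (N ^+ k.+1 / l * expR (- (r N * cos c)))).
  apply: ler_piMr; first by rewrite !mulr_ge0 ?expR_ge0 ?exprn_ge0 // ltW.
  by rewrite ler_norml cos_geN1 cos_le1.
rewrite mulrAC -(mulrA C) (mulrC l^-1) mulrA ler_pM2r //.
apply: le_trans (HC N (ltW N0)).
rewrite ler_wpM2l ?exprn_ge0 ?(ltW N0) // ler_expR lerN2.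
rewrite -powR_posE ?(ltW N0) // mulrC ler_wpM2l ?powR_pos_ge0 //.
have pi0 := pi_gt0 R.
by apply/ltW; rewrite ltr_cos // in_itv /=; apply/andP; split; lra.
Qed.

End sector_integral.

Section stieltjes.
Context {R : realType} (l : R).
Hypotheses (l0 : 0 < l) (l12 : l < 2^-1).
Local Notation mu := (@lebesgue_measure R).
Local Notation r := (powR_pos l).

Definition stieltjes_fun (x : R) : R :=
  expR (- (r x * cos (l * pi))) * sin (r x * sin (l * pi)).

Let angle : 0 < l * pi < pi / 2.
Proof.
have pi0 := pi_gt0 R.
by rewrite mulr_gt0 //= mulrC ltr_pM2l // .
Qed.

Lemma continuous_stieltjes_fun : continuous stieltjes_fun.
Proof.
have cr := continuous_powR_pos l0.
move=> x; apply: cvgM.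
  apply: continuous_comp; last exact: continuous_expR.
  by apply: cvgN; apply: cvgMr_tmp; exact: cr.
apply: continuous_comp; last exact: continuous_sin.
by apply: cvgMr_tmp; exact: cr.
Qed.

Lemma stieltjes_fun_le0 x : x <= 0 -> stieltjes_fun x = 0.
Proof. by move=> x0; rewrite /stieltjes_fun powR_pos_le0 // !mul0r sin0 mulr0. Qed.

Lemma norm_stieltjes_fun x : `|stieltjes_fun x| <= expR (- (cos (l * pi) * r x)).
Proof.
rewrite /stieltjes_fun normrM (ger0_norm (expR_ge0 _)) (mulrC (cos _)).
rewrite ler_piMr ?expR_ge0 //; by rewrite ler_norml sin_geN1 sin_le1.
Qed.

(** At the angle [l * pi] the phase [s * t] is [(k + 1) pi], a multiple of [pi]
    for every [k]: the same function therefore works for all the moments. *)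
Lemma ray_integrand_stieltjes k x :
  ray_integrand l k (l * pi) x = (- 1) ^+ k.+1 * (x ^+ k * stieltjes_fun x).
Proof.
rewrite /ray_integrand /stieltjes_fun.
have -> : k.+1%:R / l * (l * pi) = pi *+ k.+1.
  by rewrite mulrA divfK ?gt_eqF // mulr_natl.
set y := r x * sin _.
have sinB (z : R) n : sin (z - pi *+ n) = (-1) ^+ n * sin z.
  elim: n => [|n IH]; first by rewrite mulr0n subr0 expr0 mul1r.
  rewrite mulrSr opprD addrA sinB sinpi cospi mulr0 subr0 IH exprS.
  by rewrite mulrN1 mulN1r mulNr.
by rewrite sinB; ring.
Qed.

Lemma integrable_oneDsqrV : mu.-integrable `[0, +oo[ (fun x : R => (1 + x ^+ 2)^-1%:E).
Proof.
apply/integrableP; split.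
  by apply: continuous_measurable_fun_EFin; exact: continuous_oneDsqrV.
apply: (@le_lt_trans _ _ (pi / 2)%:E); last by rewrite ltry.
rewrite -integral0y_oneDsqr le_eqVlt; apply/orP; left; apply/eqP.
apply: eq_integral => x _.
by rewrite gee0_abs // lee_fin invr_ge0 addr_ge0 ?sqr_ge0.
Qed.

Lemma integrable_stieltjes_moment k :
  mu.-integrable setT (fun x => (x ^+ k * stieltjes_fun x)%:E).
Proof.
have [/andP[t0 tpi]] := angle.
have ct : 0 < cos (l * pi).
  by apply: cos_gt0_pihalf; rewrite tpi andbT; have := pi_gt0 R; lra.
have [C C0 HC] := powR_expR_dominated k ct l0.
have -> : (fun x : R => (x ^+ k * stieltjes_fun x)%:E) =
    (fun x : R => (x ^+ k * stieltjes_fun x)%:E) \_ `[0, +oo[.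
  apply/funext => x; rewrite patchE; case: ifPn => //.
  rewrite notin_setE /= in_itv /= andbT => /negP; rewrite -ltNge => x0.
  by rewrite stieltjes_fun_le0 ?mulr0 // ltW.
apply/(@integrable_mkcond _ _ _ mu `[0, +oo[ _ (measurable_itv _)).
have iC : mu.-integrable `[0, +oo[ (fun x : R => C%:E * (1 + x ^+ 2)^-1%:E)%E.
  by apply: integrableZl => //; exact: integrable_oneDsqrV.
apply: (@le_integrable _ _ _ mu _ _ _ _ _ _ iC) => //.
  apply: continuous_measurable_fun_EFin => x; apply: cvgM; first exact: exprn_continuous.
  exact: continuous_stieltjes_fun.
move=> x; rewrite /= in_itv /= andbT => x0.
rewrite lee_fin normrM normrX (ger0_norm x0).
apply: le_trans (ler_norm _); apply: le_trans (HC x x0).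
by rewrite ler_wpM2l ?exprn_ge0 // -powR_posE // norm_stieltjes_fun.
Qed.

Lemma stieltjes_moment k :
  (\int[mu]_x (x ^+ k * stieltjes_fun x)%:E = 0)%E.
Proof.
set f := fun x : R => (x ^+ k * stieltjes_fun x)%:E.
have intf : mu.-integrable setT f by exact: integrable_stieltjes_moment.
have [K K0 HK] := integral_ray_bound k l0 angle.
pose D n := `[0, n.+1%:R]%classic : set R.
have mD n : measurable (D n) by exact: measurable_itv.
have mf : measurable_fun setT f by exact: measurable_int intf.
have lim1 : (\int[mu]_(x in D n) f x)%E @[n --> \oo] --> (\int[mu]_x f x)%E.
  under eq_fun do rewrite integral_mkcond.
  have [] // := @dominated_convergence _ _ _ mu setT measurableT
    (fun n => f \_ (D n)) f (fun x => `|f x|%E).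
  - by move=> n; apply/(measurable_restrictT f (measurable_itv _)); exact: (@measurable_funS _ _ _ _ setT).
  - apply: aeW => x _; apply: cvg_near_cst.
    near=> n; rewrite patchE; case: ifPn => //.
    rewrite notin_setE /D /= in_itv /= => xn.
    rewrite /f stieltjes_fun_le0 ?mulr0 //.
    rewrite leNgt; apply/negP => x0; apply: xn; rewrite ltW //= ltW //.
    apply: lt_le_trans (truncnS_gt x) _; rewrite ler_nat ltnS.
    by near: n; exact: nbhs_infty_ge.
  - exact: integrable_abse.
  - apply: aeW => x n _; rewrite patchE; case: ifPn => // _.
    by rewrite abse0 abse_ge0.
have lim0 : (\int[mu]_(x in D n) f x)%E @[n --> \oo] --> 0%E.
  have E n : (\int[mu]_(x in D n) f x)%E =
      ((- 1) ^+ k.+1 * \int[mu]_(x in D n) ray_integrand l k (l * pi) x)%R%:E.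
    have iq : mu.-integrable (D n) (EFin \o ray_integrand l k (l * pi)).
      by apply: continuous_segment_integrable; exact: continuous_ray_integrand.
    rewrite -RintegralZl; [|exact: mD|exact: iq].
    rewrite /Rintegral -[LHS]fineK; last first.
      apply: integrable_fin_num; first exact: mD.
      by apply: (@integrableS _ _ _ mu setT) => //; exact: mD.
    congr (fine _)%:E; apply: eq_integral => x _.
    by rewrite ray_integrand_stieltjes mulrA -expr2 sqrr_sign mul1r.
  under eq_fun do rewrite E.
  apply/fine_cvgP; split; first exact: nearW.
  apply: norm_cvg0.
  apply: (@squeeze_cvgr _ _ _ _ (cst 0) (fun n => K * n.+1%:R^-1)).
  - apply: nearW => n /=; rewrite normr_ge0 /= normrM normrX normrN1 expr1n mul1r.
    apply: le_trans (HK _ (ltr0Sn _ n)) _; rewrite ler_wpM2l //.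
    rewrite lef_pV2 ?posrE ?addr_gt0 ?exprn_gt0 // expr2.
    have : 1 <= n.+1%:R :> R by rewrite ler1n.
    by move=> ?; nra.
  - exact: cvg_cst.
  - rewrite -(mulr0 K); apply: cvgMl_tmp; exact: cvg_harmonic.
exact: cvg_unique lim1 lim0.
Unshelve. all: by end_near. Qed.

End stieltjes.

(** * Lebesgue measure under affine maps and integration against a density *)

Section real_measures.
Context {R : realType}.
Local Notation mu := (@lebesgue_measure R).

(** Half-open intervals form a pi-system generating the Borel sets. *)
Lemma measure_ocitv_unique (m1 m2 : {measure set R -> \bar R}) :
  (forall a b : R, m1 `]a, b]%classic = m2 `]a, b]%classic) ->
  (forall a b : R, (m1 `]a, b]%classic < +oo)%E) ->
  forall A, measurable A -> m1 A = m2 A.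
Proof.
move=> m12 m1oo A mA.
apply: (@measure_unique _ R R (@ocitv R)
  (fun n => `]- n%:R, n%:R]%classic)) => //.
- exact: ocitvI.
- by move=> i; exact: is_ocitv.
- rewrite -subTset => x _; exists (Num.truncn `|x|).+1 => //=.
  have := truncnS_gt `|x|; rewrite ltr_norml => /andP[? ?].
  by rewrite in_itv /=; apply/andP; split => //; exact: ltW.
- by move=> _ [[a b] _ <-].
Qed.

(** Used with [a = 1] for translations and with [b = 0] for dilations. *)
Lemma lebesgue_measure_affine (a b : R) (A : set R) : 0 < a -> measurable A ->
  mu A = (a%:E * mu ((fun x => (a * x + b)%R) @^-1` A))%E.
Proof.
move=> a0 mA.
pose phi (x : R) := a * x + b.
have mphi : measurable_fun setT (phi : measurableTypeR R -> measurableTypeR R).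
  apply: continuous_measurable_fun => x.
  by apply: cvgD; [apply: cvgMl_tmp; exact: cvg_id|exact: cvg_cst].
pose m2 := mscale (NngNum (ltW a0))
  (measure_function_pushforward__canonical__measure_function_Measure mu mphi).
rewrite (@lebesgue_measure_unique R m2) // => _ [[x y] _ <-] /=.
rewrite /m2 /mscale /= /pushforward.
have -> : phi @^-1` `]x, y] = `](x - b) / a, (y - b) / a]%classic.
  apply/seteqP; split => z /=; rewrite !in_itv /= /phi.
    by rewrite ltr_pdivrMr // ler_pdivlMr // mulrC ltrBlDr lerBrDr.
  by rewrite ltr_pdivrMr // ler_pdivlMr // mulrC ltrBlDr lerBrDr.
rewrite !lebesgue_measure_itv /= !lte_fin ltr_pM2r ?invr_gt0 // ltrD2r.
case: ifPn => _; last by rewrite mule0.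
rewrite -!EFinB -EFinM; congr EFin; field; exact: lt0r_neq0.
Qed.

End real_measures.

Section translation.
Context {R : realType}.
Local Notation mu := (@lebesgue_measure R).

Lemma integrable_translation (c : R) (h : R -> \bar R) :
  measurable_fun setT h ->
  mu.-integrable setT (fun y : R => h (y + c)) ->
  mu.-integrable setT h /\ (\int[mu]_x h x = \int[mu]_y h (y + c)%R)%E.
Proof.
move=> mh ih.
pose phi (x : measurableTypeR R) : measurableTypeR R := x + c.
have mphi : measurable_fun setT phi.
  apply: continuous_measurable_fun => x.
  by apply: cvgD; [exact: cvg_id|exact: cvg_cst].
pose m2 := measure_function_pushforward__canonical__measure_function_Measure mu mphi.
have mE A : measurable A -> mu A = m2 A.
  move=> mA; rewrite (lebesgue_measure_affine c ltr01 mA) mul1e.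
  by rewrite /m2 /= /pushforward; congr (mu (_ @^-1` A)); apply/funext => x;
    rewrite mul1r.
have i2 : m2.-integrable setT h by exact: integrable_pushforward.
split.
  apply/integrableP; split => //.
  move/integrableP : i2 => [_].
  by rewrite (eq_measure_integral mu) // => A mA _; exact/esym/mE.
rewrite (eq_measure_integral m2); last by move=> A mA _; exact: mE.
exact: integral_pushforward.
Qed.

(** By the binomial formula, a moment of the translate is a linear combination
    of moments of [G]. *)
Lemma translated_moments (G : R -> R) (c : R) :
  continuous G ->
  (forall k, mu.-integrable setT (fun x => (x ^+ k * G x)%:E)) ->
  (forall k, \int[mu]_x (x ^+ k * G x)%:E = 0)%E ->
  forall k, mu.-integrable setT (fun x => (x ^+ k * G (x - c))%:E) /\
    (\int[mu]_x (x ^+ k * G (x - c))%R%:E = 0)%E.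
Proof.
move=> cG iG G0 k.
have mh : measurable_fun setT (fun x : R => (x ^+ k * G (x - c))%:E).
  apply: continuous_measurable_fun_EFin => x.
  apply: cvgM; first exact: exprn_continuous.
  apply: (@continuous_comp _ _ _ (fun x => x - c) G); last exact: cG.
  by apply: cvgB; [exact: cvg_id|exact: cvg_cst].
have E : (fun y : R => ((y + c) ^+ k * G (y + c - c))%:E) =
    (fun y => \sum_(i < k.+1) (c ^+ i *+ 'C(k, i))%:E * (y ^+ (k - i) * G y)%:E)%E.
  apply/funext => y; rewrite addrK exprDn mulr_suml -sumEFin.
  by apply: eq_bigr => i _; rewrite -EFinM; congr EFin; ring.
have int1 (i : 'I_k.+1) : mu.-integrable setT
    (fun y : R => (c ^+ i *+ 'C(k, i))%:E * (y ^+ (k - i) * G y)%:E)%E.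
  by apply: integrableZl => //; exact: iG.
have [|i1 ->] := @integrable_translation c _ mh.
  rewrite E; apply: integrable_sum => // i _; exact: int1.
split => //; rewrite E integral_sum //.
by rewrite big1 // => i _; rewrite integralZl // G0 mule0.
Qed.

End translation.

Section density.
Context {R : realType}.
Local Notation mu := (@lebesgue_measure R).
Variables (m : {measure set R -> \bar R}) (w : R -> R).
Hypothesis w0 : forall x, 0 <= w x.
Hypothesis iw : mu.-integrable setT (EFin \o w).
Hypothesis mE : forall A, measurable A -> m A = (\int[mu]_(x in A) (w x)%:E)%E.

(* [R] and [measurableTypeR R] have the same measurable sets but distinct
   displays; [m] is transported to the type that carries Lebesgue measure. *)
Let mid : measurable_fun setT (idfun : R -> measurableTypeR R).
Proof. by move=> _ A mA; rewrite setTI. Qed.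

Let m1 : {measure set (measurableTypeR R) -> \bar R} :=
  measure_function_pushforward__canonical__measure_function_Measure m mid.

Let m1E A : measurable A -> m1 A = (\int[mu]_(x in A) (w x)%:E)%E.
Proof. exact: mE. Qed.

Let m1_fin : fin_num_fun m1.
Proof.
move=> A mA; rewrite m1E //; apply: integrable_fin_num => //.
by apply: (@integrableS _ _ _ mu setT).
Qed.

Let m2 : {finite_measure set (measurableTypeR R) -> \bar R} :=
  HB.pack (Measure.sort m1) (@Measure_isFinite.Build _ _ _ m1 m1_fin).

Let m2E A : measurable A -> m2 A = (\int[mu]_(x in A) (w x)%:E)%E.
Proof. exact: mE. Qed.

Let dom : m2 `<< mu.
Proof.
apply/null_content_dominatesP => A mA A0; rewrite m2E //.
by apply: null_set_integral => //; apply: (@measurable_int _ _ _ mu);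
  apply: (@integrableS _ _ _ mu setT).
Qed.

(** The density [w] agrees almost everywhere with the Radon-Nikodym derivative,
    for which the formula is known. *)
Lemma ge0_integral_density (f : R -> \bar R) : measurable_fun setT f ->
  (forall x, 0 <= f x)%E ->
  (\int[m]_x f x = \int[mu]_x (f x * (w x)%:E))%E.
Proof.
move=> mf f0.
transitivity (\int[m2]_x f x)%E.
  by rewrite (@ge0_integral_pushforward _ _ _ _ _ _ mid) //=.
rewrite -(Radon_Nikodym_SigmaFinite.change_of_variables dom) //.
have id := Radon_Nikodym_SigmaFinite.f_integrable dom.
apply: ae_eq_integral => //.
- by apply: emeasurable_funM => //; exact: measurable_int id.
- by apply: emeasurable_funM => //; exact: measurable_int iw.
have := @integral_ae_eq _ _ _ mu setT measurableT (EFin \o w) _ id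
  (measurable_int _ iw) _.
move=> /(_ _)[|N [mN N0 sN]].
  move=> E _ mE'; rewrite -Radon_Nikodym_SigmaFinite.f_integral //.
  exact: m2E.
exists N; split => //; apply: subset_trans sN => x /=.
by apply: contra_not => /(_ I) ->.
Qed.

Lemma integrable_density (f : R -> \bar R) : measurable_fun setT f ->
  mu.-integrable setT (fun x => f x * (w x)%:E)%E ->
  m.-integrable setT f /\ (\int[m]_x f x = \int[mu]_x (f x * (w x)%:E))%E.
Proof.
move=> mf /integrableP[_ fw]; split.
  apply/integrableP; split => //.
  rewrite ge0_integral_density //; last exact: measurableT_comp.
  apply: le_lt_trans fw; rewrite le_eqVlt; apply/orP; left; apply/eqP.
  by apply: eq_integral => x _; rewrite abseM (@gee0_abs _ (w x)%:E) ?lee_fin.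
rewrite integralE [RHS]integralE.
rewrite ge0_integral_density //; last exact: measurable_funepos.
rewrite ge0_integral_density //; last exact: measurable_funeneg.
have wE x : (0 <= (w x)%:E)%E by rewrite lee_fin.
by congr (_ - _)%E; apply: eq_integral => x _;
  rewrite ?funeposE ?funenegE maxe_pMl ?mul0e ?mulNe.
Qed.

End density.

Section exists_density_measure.
Context {R : realType}.
Local Notation mu := (@lebesgue_measure R).
Variable w : R -> R.
Hypotheses (mw : measurable_fun setT w) (w0 : forall x, 0 <= w x).

Let dm (A : set R) : \bar R := (\int[mu]_(x in A) (w x)%:E)%E.

Let dm0 : dm set0 = 0%E. Proof. by rewrite /dm integral_set0. Qed.

Let dm_ge0 (A : set R) : (0 <= dm A)%E.
Proof. by apply: integral_ge0 => x _; rewrite lee_fin. Qed.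

Let dm_sigma_additive : semi_sigma_additive dm.
Proof.
apply: (@semi_sigma_additive_nng_induced _ _ _ mu (EFin \o w)).
  exact/measurable_EFinP.
by move=> x; rewrite lee_fin.
Qed.

Let dm_measure : {measure set R -> \bar R} :=
  HB.pack dm (@isMeasure.Build _ R R dm dm0 dm_ge0 dm_sigma_additive).

Lemma exists_density_measure : exists m : {measure set R -> \bar R},
  forall A, m A = (\int[mu]_(x in A) (w x)%:E)%E.
Proof. by exists dm_measure. Qed.

End exists_density_measure.

(** * Perturbing a law without changing its moments *)

Section perturbation.
Context {R : realType}.
Local Notation mu := (@lebesgue_measure R).
Variables (m0 : probability R R) (g : R -> R).
Hypothesis cg : continuous g.
Hypothesis ig : forall k, mu.-integrable setT (fun x => (x ^+ k * g x)%:E).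
Hypothesis g0 : forall k, (\int[mu]_x (x ^+ k * g x)%:E = 0)%E.
Hypothesis g_le : forall A, measurable A ->
  (\int[mu]_(x in A) `|g x|%:E <= m0 A)%E.

Let ig0 : mu.-integrable setT (EFin \o g).
Proof. by have := ig 0; under eq_fun do rewrite expr0 mul1r. Qed.

Let igA (A : set R) : measurable A -> mu.-integrable A (EFin \o g).
Proof. by move=> mA; apply: (@integrableS _ _ _ mu setT). Qed.

(** A measure must be nonnegative on nonmeasurable sets too, hence the maximum. *)
Definition perturbed (A : set R) : \bar R :=
  (maxe 0 (m0 A + \int[mu]_(x in A) (g x)%:E))%E.

Let int_fin (A : set R) : measurable A ->
  (\int[mu]_(x in A) (g x)%:E)%E \is a fin_num.
Proof. by move=> mA; apply: integrable_fin_num => //; exact: igA. Qed.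

Let perturbedE (A : set R) : measurable A ->
  perturbed A = (m0 A + \int[mu]_(x in A) (g x)%:E)%E.
Proof.
move=> mA; apply/max_idPr.
rewrite -leeBlDr ?int_fin // sub0e.
apply: le_trans (g_le mA).
apply: le_trans (lee_abs _) _; rewrite abseN.
apply: le_abse_integral => //.
by apply: (@measurable_int _ _ _ mu); exact: igA.
Qed.

Let perturbed0 : perturbed set0 = 0%E.
Proof. by rewrite perturbedE // measure0 integral_set0 adde0. Qed.

Let perturbed_ge0 (A : set R) : (0 <= perturbed A)%E.
Proof. by rewrite le_max lexx. Qed.

Let perturbed_sigma_additive : semi_sigma_additive perturbed.
Proof.
move=> F mF tF mUF; rewrite perturbedE //.
rewrite (_ : (fun n => _) = (fun n => (\sum_(0 <= i < n) m0 (F i)) +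
    (\sum_(0 <= i < n) \int[mu]_(x in F i) (g x)%:E))%E); last first.
  by apply/funext => n; rewrite -big_split; apply: eq_bigr => i _; rewrite perturbedE.
apply: cvgeD.
- by apply: fin_num_adde_defl; exact: int_fin.
- exact: measure_semi_sigma_additive.
- exact: (@charge_semi_sigma_additive _ _ _ (induced_charge ig0) F mF tF mUF).
Qed.

HB.instance Definition _ := isMeasure.Build _ R R perturbed
  perturbed0 perturbed_ge0 perturbed_sigma_additive.

Let perturbedT : perturbed setT = 1%E.
Proof.
rewrite perturbedE // probability_setT.
by have := g0 0; under eq_integral do rewrite expr0 mul1r; move=> ->; rewrite adde0.
Qed.

HB.instance Definition _ := @Measure_isProbability.Build _ R R perturbed perturbedT.

Let gp (x : R) := Num.max (g x) 0.
Let gn (x : R) := Num.max (- g x) 0.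

Let gpn x : g x = gp x - gn x.
Proof. by rewrite /gp /gn; case: (leP (g x) 0); case: (leP (- g x) 0); lra. Qed.

Let gp0 x : 0 <= gp x. Proof. by rewrite le_max lexx orbT. Qed.
Let gn0 x : 0 <= gn x. Proof. by rewrite le_max lexx orbT. Qed.

Let gp_le x : gp x <= `|g x|.
Proof. by rewrite ge_max ler_norm normr_ge0. Qed.

Let gn_le x : gn x <= `|g x|.
Proof. by rewrite ge_max -normrN ler_norm normr_ge0. Qed.

Let cgp : continuous gp.
Proof.
by move=> x; apply: (@continuous_max _ _ g (cst 0)); [exact: cg|exact: cvg_cst].
Qed.

Let cgn : continuous gn.
Proof.
move=> x; apply: (@continuous_max _ _ (fun x => - g x) (cst 0)); last exact: cvg_cst.
by apply: cvgN; exact: cg.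
Qed.

Let integrable_part (w : R -> R) k : continuous w -> (forall x, 0 <= w x) ->
  (forall x, w x <= `|g x|) ->
  mu.-integrable setT (fun x => (x ^+ k)%:E * (w x)%:E)%E.
Proof.
move=> cw w0 wg; apply: (@le_integrable _ _ _ mu _ _ _ _ _ _ (ig k)) => //.
  apply: continuous_measurable_fun_EFin => x.
  by apply: cvgM; [exact: exprn_continuous|exact: cw].
move=> x _; rewrite -EFinM lee_fin !normrM ler_wpM2l //.
by rewrite (ger0_norm (w0 x)).
Qed.

(** With [g = gp - gn], the measures [perturbed + gn dx] and [m0 + gp dx]
    coincide, and the vanishing moments of [g] say that [gp dx] and [gn dx]
    contribute equally. *)
Lemma perturbed_moments (k : nat) : m0.-integrable setT (fun x => (x ^+ k)%:E) ->
  perturbed.-integrable setT (fun x => (x ^+ k)%:E) /\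
  (\int[perturbed]_x (x ^+ k)%:E = \int[m0]_x (x ^+ k)%:E)%E.
Proof.
move=> im0.
have mX : measurable_fun setT (fun x : R => (x ^+ k)%:E).
  by apply: continuous_measurable_fun_EFin; exact: exprn_continuous.
have mc (w : R -> R) : continuous w -> measurable_fun setT w.
  by move=> cw; exact: continuous_measurable_fun.
have [P PE] := exists_density_measure (mc _ cgp) gp0.
have [N NE] := exists_density_measure (mc _ cgn) gn0.
have igp k' := @integrable_part gp k' cgp gp0 gp_le.
have ign k' := @integrable_part gn k' cgn gn0 gn_le.
have i0 (w : R -> R) : mu.-integrable setT (fun x => (x ^+ 0)%:E * (w x)%:E)%E ->
    mu.-integrable setT (EFin \o w).
  by under eq_fun do rewrite expr0 mul1e.
have [iP EP] := integrable_density gp0 (i0 _ (igp 0%N)) (fun A _ => PE A) mX (igp k).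
have [iN EN] := integrable_density gn0 (i0 _ (ign 0%N)) (fun A _ => NE A) mX (ign k).
have addE A : measurable A -> measure_add perturbed N A = measure_add m0 P A.
  move=> mA; rewrite !measure_addE PE NE /= perturbedE // -addeA; congr (_ + _)%E.
  rewrite -integralD //.
  - by apply: eq_integral => x _; rewrite gpn -EFinD subrK.
  - exact: igA.
  - by apply: (@integrableS _ _ _ mu setT) => //; apply: i0; exact: ign.
have EI : (\int[mu]_x ((x ^+ k)%:E * (gp x)%:E) =
    \int[mu]_x ((x ^+ k)%:E * (gn x)%:E))%E.
  set I2 := RHS.
  have fI2 : I2 \is a fin_num by apply: integrable_fin_num => //; exact: ign.
  rewrite -[LHS](subeK _ fI2) -integralB //.
  rewrite (_ : (\int[mu]_x _)%E = 0%E) ?add0e // -[RHS](g0 k).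
  by apply: eq_integral => x _; rewrite -!EFinM -EFinB -mulrBr -gpn.
have ipert : perturbed.-integrable setT (fun x => (x ^+ k)%:E).
  apply/integrableP; split => //.
  have mabs : measurable_fun setT (fun x : R => `|(x ^+ k)%:E|)%E.
    exact: measurableT_comp.
  apply: (@le_lt_trans _ _ (\int[measure_add perturbed N]_x `|(x ^+ k)%:E|)%E).
    by rewrite ge0_integral_measure_add // leeDl // integral_ge0.
  rewrite (eq_measure_integral (measure_add m0 P)) //; last first.
    by move=> A mA _; exact: addE.
  rewrite ge0_integral_measure_add //.
  by apply: lte_add_pinfty; [case/integrableP: im0|case/integrableP: iP].
split => //.
have := @integral_measure_add _ _ _ perturbed N setT measurableT _ ipert iN.
rewrite (eq_measure_integral (measure_add m0 P)) //; last first.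
  by move=> A mA _; exact: addE.
rewrite (integral_measure_add measurableT im0 iP) EP EN EI.
have fin : (\int[mu]_x ((x ^+ k)%:E * (gn x)%:E))%E \is a fin_num.
  by apply: integrable_fin_num => //; exact: ign.
by move=> /(congr1 (fun z => z - \int[mu]_x ((x ^+ k)%:E * (gn x)%:E))%E);
  rewrite !addeK.
Qed.

Lemma not_determined_of_perturbation : finite_moments m0 ->
  (exists2 A, measurable A & (\int[mu]_(x in A) (g x)%:E != 0)%E) ->
  ~ determined_by_moments m0.
Proof.
move=> fm [A mA gA] /(_ (perturbed : probability R R)) det.
have /(_ A mA) : forall A, measurable A -> perturbed A = m0 A.
  apply: det => k k0; first by have [] := perturbed_moments (fm k k0).
  by rewrite /moment; have [] := perturbed_moments (fm k k0).
rewrite perturbedE // => /(congr1 (fun z => z - m0 A)%E).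
have mfin : m0 A \is a fin_num by exact: fin_num_measure.
by rewrite addeAC subee // add0e => /eqP; rewrite (negbTE gA).
Qed.

End perturbation.

(** Far from [z], [x <= 2 * (x - z)] and the larger exponent [l] wins; the
    remaining [x] form a bounded set, where a small [eps] suffices. *)
Lemma stretched_exponential_comparison (R : realType) (th l C d z : R) :
  0 < th -> th < l -> 0 < C -> 0 < d -> 0 <= z ->
  exists2 eps : R, 0 < eps & forall x, z <= x ->
    eps * expR (- (d * (x - z) `^ l)) <= expR (- (C * x `^ th)).
Proof.
move=> th0 thl C0 d0 z0.
pose b := C * 2 `^ th / d.
have b0 : 0 < b by rewrite divr_gt0 ?mulr_gt0 ?powR_gt0.
(* Beyond [y0], [x - z] exceeds both [z], whence [x <= 2 * (x - z)], and the
   point where [C * (2 * y) `^ th] and [d * y `^ l] cross. *)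
pose y0 := z + b `^ (l - th)^-1.
have y00 : 0 <= y0 by rewrite addr_ge0 ?powR_ge0.
exists (expR (- (C * (y0 + z) `^ th))) => [|x zx]; first exact: expR_gt0.
rewrite -expRD ler_expR -opprD lerN2.
have yge : 0 <= x - z by lra.
have [xy|xy] := leP (x - z) y0.
  apply: (@le_trans _ _ (C * (y0 + z) `^ th)).
    rewrite ler_wpM2l ?(ltW C0) // ge0_ler_powR ?nnegrE ?(ltW th0) //; lra.
  by rewrite lerDl mulr_ge0 ?powR_ge0 // ltW.
apply: (@le_trans _ _ (d * (x - z) `^ l)); last first.
  by rewrite lerDr mulr_ge0 ?powR_ge0 // ltW.
have y0p : 0 < x - z by apply: le_lt_trans y00 xy.
have bp : 0 <= b `^ (l - th)^-1 by exact: powR_ge0.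
apply: (@le_trans _ _ (C * (2 * (x - z)) `^ th)).
  by rewrite ler_wpM2l ?(ltW C0) // ge0_ler_powR ?nnegrE ?(ltW th0) //; rewrite /y0 in xy; lra.
have -> : (x - z) `^ l = (x - z) `^ th * (x - z) `^ (l - th).
  rewrite -powRD; first by congr (_ `^ _); lra.
  by rewrite (gt_eqF y0p) implybT.
rewrite powRM // mulrA [leRHS]mulrCA [leRHS]mulrC ler_pM2r ?powR_gt0 //.
rewrite -ler_pdivrMl // -[d^-1 * _]mulrC -/b.
have -> : b = (b `^ (l - th)^-1) `^ (l - th).
  by rewrite -powRrM mulVf ?powRr1 ?(ltW b0) // subr_eq0 gt_eqF.
by apply: ge0_ler_powR; rewrite ?nnegrE //; rewrite /y0 in xy; lra.
Qed.

(** The room left by the lower bound accommodates a multiple of the translated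
    Stieltjes function, which does not change any moment. *)
Theorem not_determined_of_stretched_exponential (R : realType)
    (m0 : probability R R) (th C c z : R) :
  finite_moments m0 -> 0 < th -> th < 2^-1 -> 0 < C -> 0 < c -> 0 <= z ->
  (forall A : set R, measurable A -> A `<=` `[z, +oo[ ->
    (\int[lebesgue_measure]_(x in A) (c * expR (- (C * x `^ th)))%:E <= m0 A)%E) ->
  ~ determined_by_moments m0.
Proof.
move=> fm th0 th12 C0 c0 z0 H.
pose l := (th + 2^-1) / 2.
have thl : th < l by rewrite /l; lra.
have l12 : l < 2^-1 by rewrite /l; lra.
have l0 : 0 < l by lra.
have pi0 := pi_gt0 R.
have lpi : 0 < l * pi by rewrite mulr_gt0.
have lpi2 : l * pi < pi / 2 by rewrite mulrC ltr_pM2l.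
have ct : 0 < cos (l * pi) by apply: cos_gt0_pihalf; rewrite lpi2 andbT; lra.
have [eps eps0 Heps] := stretched_exponential_comparison th0 thl C0 ct z0.
pose K := c * eps.
have K0 : 0 < K by rewrite mulr_gt0.
pose g x := K * stieltjes_fun l (x - z).
have cG := continuous_stieltjes_fun l0.
have cg : continuous g.
  move=> x; apply: cvgMl_tmp.
  apply: (@continuous_comp _ _ _ (fun x => x - z) (stieltjes_fun l)); last exact: cG.
  by apply: cvgB; [exact: cvg_id|exact: cvg_cst].
have tm k := translated_moments z cG (integrable_stieltjes_moment l0 l12) (stieltjes_moment l0 l12) k.
have gE k : (fun x : R => (x ^+ k * g x)%:E) =
    (fun x => K%:E * (x ^+ k * stieltjes_fun l (x - z))%:E)%E.
  by apply/funext => x; rewrite -EFinM /g mulrCA.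
have ig k : lebesgue_measure.-integrable setT (fun x => (x ^+ k * g x)%:E).
  by rewrite gE; apply: integrableZl => //; have [] := tm k.
have g0 k : (\int[lebesgue_measure]_x (x ^+ k * g x)%:E = 0)%E.
  by rewrite gE integralZl //; have [] := tm k => // _ ->; rewrite mule0.
apply: (not_determined_of_perturbation cg ig g0) => //.
- move=> A mA.
  have mAz : measurable (A `&` `[z, +oo[) by exact: measurableI.
  apply: (@le_trans _ _ (m0 (A `&` `[z, +oo[))); last by apply: le_measure; rewrite ?inE.
  apply: le_trans (H _ mAz (@subIsetr _ _ _)).
  have -> : (\int[lebesgue_measure]_(x in A) `|g x|%:E =
      \int[lebesgue_measure]_(x in A `&` `[z, +oo[) `|g x|%:E)%E.
    rewrite integral_mkcondr; apply: eq_integral => x _.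
    rewrite patchE; case: ifPn => //; rewrite notin_setE /= in_itv /= andbT.
    move/negP; rewrite -ltNge => xz.
    by rewrite /g stieltjes_fun_le0 ?mulr0 ?normr0 // subr_le0 ltW.
  have mabs : measurable_fun (A `&` `[z, +oo[) (fun x => `|g x|%:E).
    apply: continuous_measurable_fun_EFin => x.
    exact: (@continuous_comp _ _ _ g (fun y : R => `|y|) x (cg x) (@norm_continuous _ _ _)).
  apply: ge0_le_integral => //.
  + apply/measurable_EFinP; apply: (@measurable_funS _ _ _ _ setT) => //.
    apply: measurable_funM => //; apply: measurableT_comp => //.
    apply: measurableT_comp => //; apply: measurable_funM => //.
  + move=> x [_]; rewrite /= in_itv /= andbT => zx.
    rewrite lee_fin /g normrM (gtr0_norm K0) /K -mulrA ler_pM2l //.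
    apply: le_trans (Heps x zx); rewrite ler_pM2l //.
    by rewrite -powR_posE ?subr_ge0 //; exact: norm_stieltjes_fun.
(* For [0 < x - z <= 1] the argument of the sine lies in [`]0, 1]], hence in
   [`]0, pi[], so the perturbation is positive there. *)
- exists `]z, z + 1]%classic => //.
  apply/negP => /eqP.
  set D := `]z, z + 1]%classic.
  have gpos x : D x -> 0 < g x.
    rewrite /D /= in_itv /= => /andP[zx xz].
    rewrite /g mulr_gt0 // /stieltjes_fun mulr_gt0 ?expR_gt0 //.
    have r1 : 0 < powR_pos l (x - z) <= 1.
      rewrite powR_posE; last lra.
      have l1 : 1 `^ l = 1 :> R by rewrite powR1.
      rewrite powR_gt0 ?subr_gt0 //= -[leRHS]l1.
      by apply: ge0_ler_powR; rewrite ?nnegrE ?(ltW l0) //; lra.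
    have st : 0 < sin (l * pi) by apply: sin_gt0_pi; rewrite lpi; lra.
    have st1 : sin (l * pi) <= 1 by exact: sin_le1.
    have pi2 := pi_ge2 R.
    move: r1 => /andP[r0 r1].
    by apply: sin_gt0_pi; rewrite mulr_gt0 //=; nra.
  have -> : (\int[lebesgue_measure]_(x in D) (g x)%:E =
      \int[lebesgue_measure]_(x in D) `|(g x)%:E|)%E.
    by apply: eq_integral => x /[!inE] /gpos gx; rewrite gee0_abs // lee_fin ltW.
  have mg : measurable_fun D (fun x => (g x)%:E).
    exact: continuous_measurable_fun_EFin.
  move/(ae_eq_integral_abs lebesgue_measure (measurable_itv _) mg) => [N [mN N0 sN]].
  have : (lebesgue_measure D <= lebesgue_measure N)%E.
    apply: le_measure; rewrite ?inE //; first exact: measurable_itv.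
    move=> x Dx; apply: sN => /= /(_ Dx) [] /eqP.
    by rewrite gt_eqF // gpos.
  rewrite N0 /D lebesgue_measure_itv /= lte_fin ltrDl ltr01 -EFinB addrAC subrr add0r.
  by rewrite lee_fin ler10.
Qed.

(** * Laws with a density and products of independent variables *)

Section law_of_density.
Context d (T : measurableType d) (R : realType) (P : probability T R).
Local Notation mu := (@lebesgue_measure R).
Variables (X : {RV P >-> R}) (f : R -> R).
Hypothesis fX : has_density X f.

Lemma law_of_density A : measurable A ->
  distribution P X A = (\int[mu]_(x in A) (f x)%:E)%E.
Proof.
have [mf f0 Xf] := fX; move=> mA.
have [m mE] := exists_density_measure mf f0.
rewrite -mE; apply: measure_ocitv_unique => // [a b|a b]; last first.
  by rewrite ltey_eq fin_num_measure.
have [ab|ba] := leP a b; last first.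
  by rewrite set_itv_ge ?measure0 // bnd_simp -leNgt ltW.
have U : `]-oo, b]%classic = `]-oo, a]%classic `|` `]a, b]%classic :> set R.
  by rewrite -itv_bndbnd_setU // bnd_simp.
have D : `]-oo, a]%classic `&` `]a, b]%classic = set0 :> set R.
  rewrite -subset0 => x [] /=; rewrite !in_itv /= => xa /andP[ax _].
  by move: ax; rewrite ltNge xa.
have mb : m `]-oo, b]%classic = distribution P X `]-oo, b]%classic.
  by rewrite mE -Xf.
have ma : m `]-oo, a]%classic = distribution P X `]-oo, a]%classic.
  by rewrite mE -Xf.
have fin : distribution P X `]-oo, a]%classic \is a fin_num.
  exact: fin_num_measure.
have e1 : distribution P X `]-oo, b]%classic =
    (distribution P X `]-oo, a]%classic + m `]a, b]%classic)%E.
  by rewrite -mb U measureU //; congr (_ + _)%E.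
have e2 : distribution P X `]-oo, b]%classic =
    (distribution P X `]-oo, a]%classic + distribution P X `]a, b]%classic)%E.
  by rewrite U measureU.
have cancel y : (distribution P X `]-oo, a]%classic + y
    - distribution P X `]-oo, a]%classic)%E = y.
  by rewrite addeAC subee // add0e.
by rewrite -[LHS]cancel -e2 e1 cancel.
Qed.

Lemma tailE x : (tail X x)%:E = distribution P X `]x, +oo[.
Proof.
rewrite /tail fineK; first by rewrite -ccdf_1_cdf.
by rewrite fin_numB /cdf !fin_num_measure.
Qed.

Lemma tail_nonincreasing x y : x <= y -> tail X y <= tail X x.
Proof.
move=> xy; rewrite -lee_fin !tailE; apply: le_measure; rewrite ?inE //.
by move=> z /=; rewrite !in_itv /= !andbT; exact: le_lt_trans.
Qed.

(** On [`]a, 2 * a]] the hazard condition bounds the density below by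
    [A * tail X (2 * a) / (2 * a)], and the interval has length [a]. *)
Lemma hazard_doubling (A a : R) : 0 < a -> 0 < A ->
  (forall x, a <= x -> 0 < tail X x) ->
  (forall x, a <= x -> A / x <= f x / tail X x) ->
  ((A / 2 * tail X (2 * a))%:E <= distribution P X `]a, (2 * a)%R])%E.
Proof.
move=> a0 A0 t0 hz; rewrite law_of_density //.
pose c := A * tail X (2 * a) / (2 * a).
have -> : (A / 2 * tail X (2 * a))%:E = (\int[mu]_(x in `]a, (2 * a)%R]) c%:E)%E.
  rewrite integral_cst //= lebesgue_measure_itv /= lte_fin.
  have -> : a < 2 * a by lra.
  rewrite -EFinB -EFinM; congr EFin; rewrite /c; field; exact: lt0r_neq0.
have [mf f0 _] := fX.
apply: ge0_le_integral => //.
- by move=> x _; rewrite lee_fin /c divr_ge0 ?mulr_ge0 ?(ltW A0) // ltW // t0; lra.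
- by apply/measurable_EFinP; apply: (@measurable_funS _ _ _ _ setT).
- move=> x; rewrite /= in_itv /= => /andP[ax x2a]; rewrite lee_fin.
  have x0 : 0 < x by lra.
  have tx : 0 < tail X x by apply: t0; exact: ltW.
  have := hz x (ltW ax); rewrite ler_pdivlMr //; apply: le_trans.
  have t2 : 0 < tail X (2 * a) by apply: t0; lra.
  rewrite /c mulrAC; apply: ler_pM; rewrite ?(ltW t2) //.
  - by rewrite divr_ge0 ?(ltW A0) //; lra.
  - by rewrite ler_pM2l // lef_pV2 // posrE; lra.
  - exact: tail_nonincreasing.
Qed.

End law_of_density.

Section independence.
Context d (T : measurableType d) (R : realType) (P : probability T R).
Context (n : nat) (xi : 'I_n -> {RV P >-> R}) (i0 : 'I_n).
Hypothesis xi_indep : mutually_independent xi.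

Definition cofactor_prod (w : T) : R := \prod_(i < n | i != i0) xi i w.

Lemma prod_fun_cofactor w : prod_fun xi w = xi i0 w * cofactor_prod w.
Proof. by rewrite /prod_fun (bigD1 i0). Qed.

(* The preimages of rectangles unconstrained in the coordinate [i0] form a
   pi-system [G]; the factorization holds on [G], hence on the sigma-algebra it
   generates, with respect to which [cofactor_prod] is measurable. *)
Let rect (A : 'I_n -> set R) : set T := \bigcap_i (xi i @^-1` A i).

Let G : set (set T) := [set E | exists A : 'I_n -> set R,
  [/\ forall i, measurable (A i), A i0 = setT & E = rect A]].

Let m_preimage i (B : set R) : measurable B -> measurable (xi i @^-1` B).
Proof. by move=> mB; rewrite -[X in measurable X]setTI; exact: measurable_funPT. Qed.

Let m_rect A : (forall i, measurable (A i)) -> measurable (rect A).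
Proof.
move=> mA; apply: fin_bigcap_measurable; first exact: finite_finset.
by move=> i _; exact: m_preimage.
Qed.

Let GI : setI_closed G.
Proof.
move=> _ _ [A [mA A0 ->]] [B [mB B0 ->]].
exists (fun i => A i `&` B i); split => [i||]; first exact: measurableI.
  by rewrite A0 B0 setTI.
apply/seteqP; split => w.
  by move=> [Aw Bw] i _; split; [exact: Aw|exact: Bw].
by move=> ABw; split => i _; have [] := ABw i I.
Qed.

Let GT : G setT.
Proof.
by exists (fun=> setT); split => //; apply/seteqP; split.
Qed.

Let indep_G (B : set R) : measurable B -> forall E, <<s G >> E ->
  P (E `&` xi i0 @^-1` B) = (P (xi i0 @^-1` B) * P E)%E.
Proof.
move=> mB E GE.
have mXB := m_preimage i0 mB.
have c0 : 0 <= fine (P (xi i0 @^-1` B)) by rewrite fine_ge0.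
pose m1 := mrestr P mXB.
pose m2 := mscale (NngNum c0) P.
have -> : (P (xi i0 @^-1` B) * P E)%E = m2 E.
  by rewrite /m2 /mscale /= fineK // fin_num_measure.
rewrite -[LHS]/(m1 E).
apply: (@g_sigma_algebra_measure_unique _ _ _ G _ (fun=> setT)) => //.
- by move=> _ [A [mA _ ->]]; exact: m_rect.
- by rewrite bigcup_const.
- move=> _ [A [mA A0 ->]].
  rewrite -[RHS]/((fine (P (xi i0 @^-1` B)))%:E * P (rect A))%E.
  rewrite -[LHS]/(P (rect A `&` xi i0 @^-1` B)) fineK ?fin_num_measure //.
  pose A' i := if i == i0 then B else A i.
  have mA' i : measurable (A' i) by rewrite /A'; case: ifP.
  have -> : rect A `&` xi i0 @^-1` B = rect A'.
    apply/seteqP; split => w.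
      move=> [Aw Bw] i _; rewrite /A'; case: eqP => [->//|_]; exact: Aw.
    move=> Aw; split; last by have := Aw i0 I; rewrite /A' eqxx.
    move=> i _; have := Aw i I; rewrite /A'; case: eqP => // -> _.
    by rewrite A0.
  rewrite (xi_indep mA') (xi_indep mA) (bigD1 i0) //= [in RHS](bigD1 i0) //=.
  rewrite /A' eqxx A0 preimage_setT probability_setT mul1e.
  by congr (_ * _)%E; apply: eq_bigr => i /negbTE ->.
- by move=> k; rewrite ltey_eq fin_num_measure.
Qed.

Let mY : measurable_fun setT (cofactor_prod : g_sigma_algebraType G -> R).
Proof.
have -> : cofactor_prod = fun w => \prod_(i < n) (if i != i0 then xi i w else 1).
  by apply/funext => w; rewrite /cofactor_prod big_mkcond.
apply: measurable_prod => i _ /=.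
have [_|ii0] := eqVneq i i0; first exact: measurable_cst.
move=> _ B mB; rewrite setTI; apply: sub_sigma_algebra.
exists (fun j => if j == i then B else setT); split.
- by move=> j; case: ifP.
- by rewrite eq_sym (negbTE ii0).
- apply/seteqP; split => w.
    by move=> Bw j _; case: eqP => // ->.
  by move=> /(_ i I); rewrite eqxx.
Qed.

Lemma measurable_cofactor_prod : measurable_fun setT cofactor_prod.
Proof.
have -> : cofactor_prod = fun w => \prod_(i < n) (if i != i0 then xi i w else 1).
  by apply/funext => w; rewrite /cofactor_prod big_mkcond.
apply: measurable_prod => i _ /=.
by have [_|ii0] := eqVneq i i0; [exact: measurable_cst|exact: measurable_funPT].
Qed.

Lemma independent_cofactor (B C : set R) : measurable B -> measurable C ->
  P (cofactor_prod @^-1` C `&` xi i0 @^-1` B) =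
  (P (cofactor_prod @^-1` C) * P (xi i0 @^-1` B))%E.
Proof.
move=> mB mC; rewrite muleC; apply: indep_G => //.
by have := mY measurableT mC; rewrite setTI.
Qed.

End independence.

Section product_of_independent.
Context d (T : measurableType d) (R : realType) (P : probability T R).
Local Notation mu := (@lebesgue_measure R).
Variables (X : {RV P >-> R}) (Y : T -> R) (f : R -> R).
Hypothesis mY : measurable_fun setT Y.
Hypothesis indep : forall B C : set R, measurable B -> measurable C ->
  P (Y @^-1` C `&` X @^-1` B) = (P (Y @^-1` C) * P (X @^-1` B))%E.
Hypothesis fX : has_density X f.

Let Y' : {RV P >-> R} := HB.pack Y (@isMeasurableFun.Build _ _ T R Y mY).

Let mXY : measurable_fun setT (fun w => (Y w, X w)).
Proof. by apply: measurable_fun_pair => //; exact: measurable_funPT. Qed.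

Let joint : {measure set (R * R) -> \bar R} :=
  measure_function_pushforward__canonical__measure_function_Measure P mXY.

Let jointE (S : set (R * R)) : measurable S ->
  joint S = (\int[distribution P Y']_y distribution P X (xsection S y))%E.
Proof.
move=> mS; rewrite -(@product_measure_unique _ _ _ _ _
  (distribution P Y') (distribution P X) joint) // => C B mC mB.
exact: indep.
Qed.

(** Conditionally on [Y = y] with [a <= y <= b], the product has density
    [f (z / y) / y >= k / b] at each [z] in [A]. *)
Lemma product_law_lower_bound (k a b w w' : R) (A : set R) :
  0 <= k -> 0 < a -> a <= b -> 0 <= w -> measurable A -> A `<=` `[w, w'] ->
  (forall x, w / b <= x -> x <= w' / a -> k <= f x) ->
  ((k / b)%:E * mu A * P (Y @^-1` `[a, b]) <= P ((fun t => X t * Y t)%R @^-1` A))%E.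
Proof.
move=> k0 a0 ab w0 mA Aw fk.
have b0 : 0 < b by lra.
pose S : set (R * R) := (`[a, b]%classic `*` setT) `&` ((fun u => u.2 * u.1) @^-1` A).
have mh : measurable_fun setT (fun u : R * R => u.2 * u.1).
  by apply: measurable_funM; [exact: measurable_snd|exact: measurable_fst].
have mprod : measurable_fun setT (fun t => X t * Y t).
  by apply: measurable_funM; [exact: measurable_funPT|exact: mY].
have mS : measurable S.
  apply: measurableI; first exact: measurableX.
  by rewrite -[X in measurable X]setTI; exact: mh.
apply: (@le_trans _ _ (joint S)); last first.
  rewrite -[leLHS]/(P ((fun w => (Y w, X w)) @^-1` S)).
  apply: le_measure; rewrite ?inE.
  - by rewrite -[X in measurable X]setTI; exact: mXY.
  - by rewrite -[X in measurable X]setTI; exact: mprod.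
  - by move=> t [_].
have mAfin : mu A \is a fin_num.
  rewrite ge0_fin_numE //.
  apply: (@le_lt_trans _ _ (mu `[w, w'])).
    by apply: le_measure; rewrite ?inE //; exact: measurable_itv.
  by rewrite lebesgue_measure_itv /=; case: ifP => _; rewrite ?ltry // -EFinB ltry.
rewrite jointE //.
have -> : ((k / b)%:E * mu A * P (Y @^-1` `[a, b]))%E =
    (\int[distribution P Y']_(y in `[a, b]) ((k / b)%:E * mu A))%E.
  rewrite -(fineK mAfin) -EFinM integral_cst //=.
apply: (@le_trans _ _ (\int[distribution P Y']_(y in `[a, b])
    distribution P X (xsection S y))%E); last first.
  by apply: ge0_subset_integral => //; exact: measurable_fun_xsection.
apply: ge0_le_integral => //.
  by move=> y _; rewrite mule_ge0 // lee_fin divr_ge0 // ltW.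
  by apply: (@measurable_funS _ _ _ _ setT) => //; exact: measurable_fun_xsection.
move=> y; rewrite /= in_itv /= => /andP[ay yb].
have y0 : 0 < y by lra.
pose B := xsection S y.
have mB : measurable B by exact: measurable_xsection.
have BE : B = (fun x => y * x + 0) @^-1` A.
  apply/seteqP; split => x /=; rewrite addr0.
    by rewrite /B /xsection /= inE /S => -[_] /=; rewrite mulrC.
  by move=> yxA; rewrite /B /xsection /= inE /S /= in_itv /= ay yb mulrC.
rewrite (lebesgue_measure_affine 0 y0 mA) -BE.
rewrite -/B (law_of_density fX) //.
have [mf f0 _] := fX.
apply: (@le_trans _ _ (\int[mu]_(x in B) k%:E)%E); last first.
  apply: ge0_le_integral => //.
  - by apply/measurable_EFinP; apply: (@measurable_funS _ _ _ _ setT).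
  - move=> x; rewrite BE /= addr0 => yxA; rewrite lee_fin.
    have := Aw _ yxA; rewrite /= in_itv /= => /andP[wx xw].
    have x0 : 0 <= x by rewrite -(pmulr_rge0 _ y0); lra.
    apply: fk.
      by rewrite ler_pdivrMr //; nra.
    by rewrite ler_pdivlMr //; nra.
rewrite integral_cst // muleA -EFinM.
apply: lee_wpmul2r => //.
rewrite lee_fin mulrAC ler_pdivrMr // ler_wpM2l //.
Qed.

End product_of_independent.

(** Since [h] decreases, its value at the left end of a window bounds it on the
    whole window, and countable additivity glues the windows. *)
Lemma lower_bound_of_unit_windows (R : realType) (m : {measure set R -> \bar R})
    (h : R -> R) (z : R) :
  measurable_fun setT h -> (forall x, 0 <= h x) ->
  (forall x y, z <= x -> x <= y -> h y <= h x) ->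
  (forall w (A : set R), z <= w -> measurable A -> A `<=` `[w, w + 1[ ->
    ((h w)%:E * lebesgue_measure A <= m A)%E) ->
  forall A : set R, measurable A -> A `<=` `[z, +oo[ ->
    (\int[lebesgue_measure]_(x in A) (h x)%:E <= m A)%E.
Proof.
move=> mh h0 hd H A mA Az.
pose W (j : nat) : set R := `[z + j%:R, z + j%:R + 1[%classic.
pose D j := A `&` W j.
have mW j : measurable (W j) by exact: measurable_itv.
have mD j : measurable (D j) by exact: measurableI.
have disj i j : (i < j)%N -> D i `&` D j = set0.
  move=> ij; rewrite -subset0 => x [[_ Wi] [_ Wj]]; move: Wi Wj.
  rewrite /W /= !in_itv /= => /andP[_ xi] /andP[jx _].
  have : i.+1%:R <= j%:R :> R by rewrite ler_nat.
  by rewrite -natr1 => ?; exfalso; lra.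
have AD : A = \bigcup_j D j.
  apply/seteqP; split => [x Ax|x [j _ []//]].
  have zx : z <= x by have := Az _ Ax; rewrite /= in_itv /= andbT.
  exists (Num.truncn (x - z)) => //; split => //=.
  have /andP[] := @truncn_itv R (x - z) (eq_ind_r is_true zx (subr_ge0 z x)).
  rewrite -natr1 => h1 h2; rewrite /W /= in_itv /=; apply/andP; split; lra.
have tD : trivIset setT D.
  apply/trivIsetP => i j _ _; rewrite neq_ltn => /orP[|] ij; first exact: disj.
  by rewrite setIC disj.
rewrite [in leLHS]AD [in leRHS]AD measure_bigcup //.
rewrite ge0_integral_bigcup //; last 2 first.
- by apply/measurable_EFinP; apply: (@measurable_funS _ _ _ _ setT).
- by move=> x _; rewrite lee_fin.
rewrite [leRHS](@eq_eseriesl _ _ xpredT); last by move=> i; rewrite in_setT.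
apply: lee_nneseries => j _.
  by move=> _; apply: integral_ge0 => x _; rewrite lee_fin.
have zj : z <= z + j%:R by rewrite lerDl.
apply: le_trans (H _ _ zj (mD j) (@subIsetr _ _ _)).
rewrite -(@integral_cst _ _ _ lebesgue_measure (D j)); last exact: mD.
apply: ge0_le_integral => //.
- exact: mD.
- by move=> x _; rewrite lee_fin.
- by apply/measurable_EFinP; apply: (@measurable_funS _ _ _ _ setT).
- move=> x [_]; rewrite /W /= in_itv /= => /andP[jx _].
  by rewrite lee_fin hd.
Qed.

(** The product is at most the [n.+1]-st power of the largest factor. *)
Lemma prod_le_sum_expn (R : realDomainType) (n : nat) (a : 'I_n.+1 -> R) :
  (forall i, 0 <= a i) -> \prod_i a i <= \sum_i a i ^+ n.+1.
Proof.
move=> a0; case: (@Order.TotalTheory.arg_maxP _ R _ (@ord0 n) xpredT a isT) => j _ aj.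
apply: (@le_trans _ _ (a j ^+ n.+1)).
  apply: (@le_trans _ _ (\prod_(i < n.+1) a j)); last by rewrite prodr_const card_ord.
  by apply: ler_prod => i _; rewrite a0; exact: aj.
by rewrite (bigD1 j) //= lerDl sumr_ge0 // => i _; rewrite exprn_ge0.
Qed.

Lemma finite_moments_prod d (T : measurableType d) (R : realType)
    (P : probability T R) (n : nat) (xi : 'I_n -> {RV P >-> R}) :
  (0 < n)%N -> (forall i, finite_moments (distribution P (xi i))) ->
  finite_moments (distribution P (prod_fun xi : {RV P >-> R})).
Proof.
case: n xi => // n xi _ fm k k0.
have mX : measurable_fun setT (fun x : R => (x ^+ k)%:E).
  by apply: continuous_measurable_fun_EFin; exact: exprn_continuous.
have iabs i : P.-integrable setT (fun w => (`|xi i w| ^+ (n.+1 * k))%:E).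
  have nk0 : (0 < n.+1 * k)%N by rewrite muln_gt0.
  have /integrableP[mf fin] := fm i _ nk0.
  apply/integrableP; split.
    apply/measurable_EFinP; apply: measurable_funX; apply: measurableT_comp => //.
  rewrite ge0_integral_distribution // in fin; last exact: measurableT_comp.
  apply: le_lt_trans fin; rewrite le_eqVlt; apply/orP; left; apply/eqP.
  by apply: eq_integral => w _ /=; rewrite ger0_norm ?exprn_ge0 // normrX.
apply: integrable_pushforward => //.
apply: (@le_integrable _ _ _ P setT _ _ (fun w => \sum_(i < n.+1) (`|xi i w| ^+ (n.+1 * k))%:E)%E) => //.
- by apply: measurableT_comp => //; exact: measurable_funPT.
- move=> w _; rewrite sumEFin /= lee_fin.
  have sum0 : 0 <= \sum_(i < n.+1) `|xi i w| ^+ (n.+1 * k).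
    by apply: sumr_ge0 => i _; rewrite exprn_ge0.
  rewrite (ger0_norm sum0) normrX /prod_fun normr_prod -prodrXl.
  have a0 i : 0 <= `|xi i w| ^+ k by rewrite exprn_ge0.
  apply: (le_trans (prod_le_sum_expn a0)).
  by apply: ler_sum => i _; rewrite -exprM mulnC.
- by apply: integrable_sum => // i _; exact: iabs.
Qed.

(** * Lower bound for the law of the product *)

Lemma prod_powR (R : realType) (I : finType) (w : R) (e : I -> R) :
  0 < w -> \prod_i w `^ e i = w `^ (\sum_i e i).
Proof.
move=> w0; elim/big_rec2: _ => [|i x y _ ->]; first by rewrite powRr0.
by rewrite powRD // (gt_eqF w0) implybT.
Qed.

(** At the scale [w `^ (th / beta)] the leading term of the tail bound is an
    exponential of [w `^ th] whatever [beta] is, and the power of exponent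
    [gamma] is absorbed since [ln w] is at most a multiple of [w `^ th]. *)
Lemma tail_at_power_scale (R : realType) (t : R -> R)
    (x0 B alpha beta gamma th : R) :
  0 < B -> 0 < alpha -> 0 < beta -> 0 < th ->
  (forall x, x0 <= x ->
    B * x `^ gamma * expR (- (alpha * x `^ beta)) <= t x) ->
  exists2 K : R, 0 < K & forall w, 1 <= w -> x0 <= 2 * w `^ (th / beta) ->
    B * expR (- (K * w `^ th)) <= t (2 * w `^ (th / beta)).
Proof.
move=> B0 al0 be0 th0 H.
have bi0 : 0 < beta^-1 by rewrite invr_gt0.
exists (alpha * 2 `^ beta + `|gamma| * (1 + beta^-1)) => [|w w1 xw].
  by rewrite ltr_wpDr ?mulr_ge0 ?mulr_gt0 ?powR_gt0 //; lra.
apply: le_trans (H _ xw).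
have w0 : 0 < w by lra.
set W := w `^ th.
have W1 : 1 <= W.
  have l1 : 1 `^ th = 1 :> R by rewrite powR1.
  by rewrite -[leLHS]l1 ge0_ler_powR ?nnegrE ?(ltW th0) //; lra.
set a := w `^ (th / beta).
have a0 : 0 < a by exact: powR_gt0.
have ab : (2 * a) `^ beta = 2 `^ beta * W.
  by rewrite powRM ?(ltW a0) // -powRrM divfK // gt_eqF.
have a1 : 1 <= a.
  have l1 : 1 `^ (th / beta) = 1 :> R by rewrite powR1.
  by rewrite -[leLHS]l1 ge0_ler_powR ?nnegrE ?divr_ge0 ?(ltW th0) ?(ltW be0) //; lra.
have lnu : `|ln (2 * a)| <= (1 + beta^-1) * W.
  rewrite ger0_norm; last by rewrite ln_ge0 //; lra.
  rewrite lnM ?posrE //.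
  have -> : ln a = beta^-1 * ln W.
    by rewrite !ln_powR mulrA; congr (_ * _); rewrite mulrC.
  have l2 : ln 2 <= 1 :> R.
    by rewrite -ler_expR lnK ?posrE //; have := expR_ge1Dx (1 : R); lra.
  have lW : ln W <= W by apply/ltW/ln_sublinear; lra.
  rewrite mulrDl mul1r lerD ?ler_pM2l //; lra.
rewrite -mulrA ler_pM2l // ab.
have u0 : 0 < 2 * a by lra.
have -> : (2 * a) `^ gamma = expR (gamma * ln (2 * a)).
  by rewrite /powR (gt_eqF u0).
rewrite -expRD ler_expR.
have : - (gamma * ln (2 * a)) <= `|gamma| * ((1 + beta^-1) * W).
  apply: le_trans (ler_norm _) _; rewrite normrN normrM.
  by rewrite ler_wpM2l.
lra.
Qed.

Section product_density.
Context (d : measure_display) (T : measurableType d) (R : realType)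
  (P : probability T R) (n : nat) (xi : 'I_n -> {RV P >-> R})
  (f : 'I_n -> R -> R) (x0 : R) (A : 'I_n -> R) (i0 : 'I_n).
Hypothesis xi_indep : mutually_independent xi.
Hypothesis xi_density : forall i, has_density (xi i) (f i).
Hypothesis x0_gt0 : 0 < x0.
Hypothesis f_decreasing : forall x y, x0 <= x -> x <= y -> f i0 y <= f i0 x.
Hypothesis A_gt0 : forall i, 0 < A i.
Hypothesis tail_gt0 : forall i x, x0 <= x -> 0 < tail (xi i) x.
Hypothesis hazard_ge : forall i x, x0 <= x -> A i / x <= f i x / tail (xi i) x.

(** The factors other than [i0] are confined to the blocks [`]a j, 2 * a j]], and
    the density of the factor [i0] is then evaluated between [a i0 / 2 ^+ n] and
    [2 * a i0], where it is at least its value at the right end. The first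
    hypothesis keeps this range inside the domain of monotonicity. *)
Lemma product_window_bound (a : 'I_n -> R) (D : set R) :
  (forall i, 2 ^+ n * x0 <= a i) -> measurable D ->
  D `<=` `[\prod_i a i, 2 * \prod_i a i] ->
  (((\prod_i (A i / 2 * tail (xi i) (2 * a i))) / (2 ^+ n * \prod_i a i))%:E
     * lebesgue_measure D <= distribution P (prod_fun xi : {RV P >-> R}) D)%E.
Proof.
move=> ax mD Dw.
have n1 : 1 <= 2 ^+ n :> R by rewrite exprn_ege1 //; lra.
have xa i : x0 <= a i.
  by apply: le_trans (ax i); rewrite ler_peMl // ltW.
have a0 i : 0 < a i by apply: lt_le_trans (xa i).
pose q i := A i / 2 * tail (xi i) (2 * a i).
have q0 i : 0 < q i.
  rewrite /q mulr_gt0 ?divr_gt0 ?A_gt0 // tail_gt0 //.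
  by have := xa i; have := a0 i; lra.
rewrite -/(\prod_i q i).
set w := \prod_i a i.
pose a' := \prod_(j < n | j != i0) a j.
pose b := \prod_(j < n | j != i0) (2 * a j).
have a'0 : 0 < a' by apply: prodr_gt0.
have wE : w = a i0 * a' by rewrite /w (bigD1 i0).
have ab : a' <= b.
  by apply: ler_prod => j _; rewrite ltW ?a0 //=; have := a0 j; lra.
have b0 : 0 < b by lra.
have bw : b <= 2 ^+ n * a'.
  rewrite /b big_split /= ler_pM2r // prodr_const ler_eXn2l ?ltr1n //.
  by rewrite -[leqRHS]card_ord max_card.
pose k := q i0 / a i0.
have fk x : w / b <= x -> x <= 2 * w / a' -> k <= f i0 x.
  have -> : 2 * w / a' = 2 * a i0 by rewrite wE; field; exact: lt0r_neq0.
  move=> wx x2; have x0x : x0 <= x.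
    apply: le_trans wx; rewrite ler_pdivlMr //.
    apply: (@le_trans _ _ (x0 * (2 ^+ n * a'))); first by rewrite ler_pM2l.
    by rewrite mulrA wE ler_pM2r // mulrC.
  apply: le_trans (f_decreasing x0x x2).
  have x2a : x0 <= 2 * a i0 by have := xa i0; have := a0 i0; lra.
  have := hazard_ge i0 x2a; rewrite ler_pdivlMr ?tail_gt0 //; apply: le_trans.
  rewrite le_eqVlt; apply/orP; left; apply/eqP.
  by rewrite /k /q; field; exact: lt0r_neq0.
have k0 : 0 <= k by rewrite divr_ge0 // ltW.
have := product_law_lower_bound (measurable_cofactor_prod xi i0)
  (independent_cofactor i0 xi_indep) (xi_density i0) k0 a'0 ab _ mD Dw fk.
move=> /(_ (ltW _)) H.
have w0 : 0 < w by rewrite wE mulr_gt0.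
have -> : distribution P (prod_fun xi : {RV P >-> R}) D =
    P ((fun t => xi i0 t * cofactor_prod xi i0 t) @^-1` D).
  rewrite /distribution /pushforward; congr (P (_ @^-1` D)).
  by apply/funext => t; rewrite /= (prod_fun_cofactor xi i0).
apply: le_trans (H w0).
rewrite muleAC; apply: lee_wpmul2r => //.
(* On the rectangle with sides [E] the cofactor product lies in [[a', b]], and
   by independence its probability is a product of one-variable bounds. *)
pose E i : set R := if i == i0 then setT else `]a i, 2 * a i]%classic.
have mE i : measurable (E i) by rewrite /E; case: ifP.
have m_preimage i (B : set R) : measurable B -> measurable (xi i @^-1` B).
  by move=> mB; rewrite -[X in measurable X]setTI; exact: measurable_funPT.
have PE : ((\prod_(j < n | j != i0) q j)%:E <= P (\bigcap_i (xi i @^-1` E i)))%E.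
  have E0 : E i0 = setT by rewrite /E eqxx.
  rewrite (xi_indep mE) [in leRHS](bigD1 i0) //= E0 preimage_setT probability_setT mul1e.
  have qP j : j != i0 -> ((q j)%:E <= P (xi j @^-1` E j))%E.
    move=> ji0; rewrite /E (negbTE ji0).
    by apply: (hazard_doubling (xi_density j)) => // x ajx;
      [apply: tail_gt0|apply: hazard_ge]; exact: le_trans (xa j) ajx.
  rewrite -prodEFin.
  suff /andP[] : ((0 <= \prod_(j < n | j != i0) (q j)%:E) &&
      (\prod_(j < n | j != i0) (q j)%:E <=
       \prod_(j < n | j != i0) P (xi j @^-1` E j)))%E by [].
  elim/big_rec2: _ => [|j x y ji0 /andP[y0 yx]]; first by rewrite lexx lee_fin ler01.
  have qj : (0 <= (q j)%:E)%E by rewrite lee_fin ltW.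
  by rewrite mule_ge0 //= lee_pmul // qP.
have EY : \bigcap_i (xi i @^-1` E i) `<=` cofactor_prod xi i0 @^-1` `[a', b].
  move=> t Et; rewrite /= in_itv /=; apply/andP; split.
    apply: ler_prod => j ji0; rewrite (ltW (a0 j)) /=.
    by have : E j (xi j t) := Et j I; rewrite /E (negbTE ji0) /= in_itv /= => /andP[/ltW].
  apply: ler_prod => j ji0.
  have : E j (xi j t) := Et j I; rewrite /E (negbTE ji0) /= in_itv /= => /andP[ajx ->].
  by rewrite andbT ltW // (lt_trans _ ajx).
have PY : ((\prod_(j < n | j != i0) q j)%:E <=
    P (cofactor_prod xi i0 @^-1` `[a', b]))%E.
  apply: le_trans PE _; apply: le_measure; rewrite ?inE //.
    by apply: fin_bigcap_measurable => [|i _]; [exact: finite_finset|exact: m_preimage].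
  by rewrite -[X in measurable X]setTI; apply: measurable_cofactor_prod.
apply: (@le_trans _ _ ((k / b)%:E * (\prod_(j < n | j != i0) q j)%:E)%E).
  rewrite -EFinM lee_fin (bigD1 i0) //=.
  have qi0 : 0 < \prod_(j < n | j != i0) q j by apply: prodr_gt0.
  rewrite mulrAC ler_pM2r // /k -mulrA ler_pM2l // -invfM lef_pV2 ?posrE ?mulr_gt0 //.
  by rewrite wE mulrCA ler_pM2l.
by rewrite lee_wpmul2l // lee_fin divr_ge0 // ltW.
Qed.

End product_density.

Unset Implicit Arguments.

Theorem theorem7 (d : measure_display) (T : measurableType d) (R : realType)
    (P : probability T R) (n : nat) (hn : (2 <= n)%N)
    (xi : 'I_n -> {RV P >-> R}) (f : 'I_n -> R -> R)
    (x0 : R) (A B alpha beta gamma : 'I_n -> R)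
    (xi_indep : mutually_independent xi)
    (xi_ge0 : forall i, {ae P, forall w, 0 <= xi i w})
    (xi_moments : forall i, finite_moments (distribution P (xi i)))
    (xi_density : forall i, has_density (xi i) (f i))
    (f_gt0 : forall i x, 0 < x -> 0 < f i x)
    (x0_ge1 : 1 <= x0)
    (f_decreasing : exists i, forall x y, x0 <= x -> x <= y -> f i y <= f i x)
    (A_gt0 : forall i, 0 < A i)
    (hazard_ge : forall i x, x0 <= x -> A i / x <= f i x / tail (xi i) x)
    (B_gt0 : forall i, 0 < B i)
    (alpha_gt0 : forall i, 0 < alpha i)
    (beta_gt0 : forall i, 0 < beta i)
    (tail_ge : forall i x, x0 <= x ->
       B i * x `^ gamma i * expR (- (alpha i * x `^ beta i)) <= tail (xi i) x)
    (beta_sum : 2 < \sum_(i < n) (beta i)^-1) :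
  M_indet (prod_fun xi : {RV P >-> R}).
Proof.
have fm : finite_moments (distribution P (prod_fun xi : {RV P >-> R})).
  by apply: finite_moments_prod => //; exact: ltnW.
split => // -[_]; case: f_decreasing => i0 f_dec.
have x00 : 0 < x0 by lra.
have tail_gt0 i x : x0 <= x -> 0 < tail (xi i) x.
  move=> x0x; apply: lt_le_trans (tail_ge i x x0x).
  by rewrite !mulr_gt0 ?expR_gt0 ?powR_gt0 //; lra.
set S := \sum_(i < n) _ in beta_sum.
have S0 : 0 < S by lra.
pose th := S^-1.
have th0 : 0 < th by rewrite invr_gt0.
have th12 : th < 2^-1 by rewrite ltf_pV2 // posrE.
pose e i := th / beta i.
have e0 i : 0 < e i by rewrite divr_gt0.
have e1 : \sum_i e i = 1 by rewrite -mulr_sumr mulVf // gt_eqF.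
have /choice[K HK] : forall i, exists K : R, 0 < K /\ forall w, 1 <= w ->
    x0 <= 2 * w `^ e i ->
    B i * expR (- (K * w `^ th)) <= tail (xi i) (2 * w `^ e i).
  move=> i; have [K K0 H] := tail_at_power_scale (B_gt0 i) (alpha_gt0 i)
    (beta_gt0 i) th0 (tail_ge i).
  by exists K.
have K0 i : 0 < K i by have [] := HK i.
(* From [z] on, every scale [w `^ e i] exceeds [2 ^+ n * x0]; a sum replaces the
   maximum of the thresholds. *)
pose z := 1 + \sum_i (2 ^+ n * x0) `^ (e i)^-1.
have z1 : 1 <= z by rewrite lerDl sumr_ge0 // => i _; exact: powR_ge0.
have n0 : 0 < 2 ^+ n :> R by rewrite exprn_gt0.
have large i w : z <= w -> 2 ^+ n * x0 <= w `^ e i.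
  move=> zw; have w0 : 0 <= w by lra.
  have -> : 2 ^+ n * x0 = ((2 ^+ n * x0) `^ (e i)^-1) `^ e i.
    by rewrite -powRrM mulVf ?powRr1 ?gt_eqF // ltW // mulr_gt0.
  apply: ge0_ler_powR; rewrite ?nnegrE ?powR_ge0 ?(ltW (e0 i)) //.
  apply: le_trans zw; rewrite /z (bigD1 i) //= addrCA lerDl addr_ge0 //.
  by rewrite sumr_ge0 // => j _; exact: powR_ge0.
pose c := (\prod_i (A i / 2 * B i)) / 2 ^+ n.
pose C := \sum_i K i + th^-1.
have c0 : 0 < c.
  by rewrite divr_gt0 //; apply: prodr_gt0 => i _; rewrite !mulr_gt0.
have C0 : 0 < C.
  rewrite ltr_wpDl ?invr_gt0 //.
  by apply: sumr_ge0 => i _; exact: ltW.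
apply: (not_determined_of_stretched_exponential fm th0 th12 C0 c0 (z := z)); first lra.
apply: lower_bound_of_unit_windows.
- apply: measurable_funM => //; apply: measurableT_comp => //.
  apply: measurableT_comp => //; apply: measurable_funM => //.
- by move=> x; rewrite mulr_ge0 ?expR_ge0 // ltW.
- move=> x y zx xy; rewrite ler_pM2l // ler_expR lerN2 ler_pM2l //.
  by apply: ge0_ler_powR; rewrite ?nnegrE ?(ltW th0) //; lra.
move=> w D zw mD Dw.
have w1 : 1 <= w by lra.
have w0 : 0 < w by lra.
pose a i := w `^ e i.
have prod_a : \prod_i a i = w by rewrite prod_powR // e1 powRr1 // ltW.
have x2a i : x0 <= 2 * a i.
  apply: le_trans (_ : 2 ^+ n * x0 <= _); last first.
    by apply: le_trans (large i w zw) _; rewrite ler_peMl ?powR_ge0 //; lra.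
  by rewrite ler_peMl ?(ltW x00) // exprn_ege1 //; lra.
have Dw2 : D `<=` `[\prod_i a i, 2 * \prod_i a i].
  move=> x /Dw; rewrite prod_a /= !in_itv /= => /andP[-> ?] /=; lra.
apply: le_trans (product_window_bound xi_indep xi_density x00 f_dec A_gt0
  tail_gt0 hazard_ge (fun i => large i w zw) mD Dw2).
apply: lee_wpmul2r => //; rewrite lee_fin prod_a.
have prod_tail : \prod_i (A i / 2 * B i) * expR (- (\sum_i K i * w `^ th)) <=
    \prod_i (A i / 2 * tail (xi i) (2 * a i)).
  rewrite -sumrN expR_sum -big_split /=; apply: ler_prod => i _.
  rewrite !mulr_ge0 ?expR_ge0 ?divr_ge0 ?(ltW (A_gt0 i)) ?(ltW (B_gt0 i)) //=.
  rewrite -[X in X <= _]mulrA ler_pM2l ?divr_gt0 //.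
  by have [_ H] := HK i; exact: (H w w1 (x2a i)).
(* The factor [w^-1] of the window bound costs only a change of [C]. *)
have wE : expR (- (th^-1 * w `^ th)) <= w^-1.
  rewrite expRN lef_pV2 ?posrE ?expR_gt0 //.
  rewrite -[leLHS](lnK (x := w)) ?posrE // ler_expR.
  rewrite mulrC ler_pdivlMr // mulrC -ln_powR.
  by apply/ltW/ln_sublinear; exact: powR_gt0.
rewrite /c /C mulrDl opprD expRD invfM.
rewrite [leLHS](_ : _ = (\prod_i (A i / 2 * B i) * expR (- (\sum_i K i * w `^ th)))
    * ((2 ^+ n)^-1 * expR (- (th^-1 * w `^ th)))); last first.
  by rewrite -mulr_suml; ring.
apply: ler_pM => //.
- by rewrite mulr_ge0 ?expR_ge0 // prodr_ge0 // => i _; rewrite !mulr_ge0 // ltW.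
- by rewrite ler_pM2l // invr_gt0.
Qed.
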